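(* Let $\mathcal J=\mathcal J_{n_1}(\lambda_1)\oplus\cdots\oplus\mathcal J_{n_p}(\lambda_p)$ be a real $N\times N$ Jordan matrix with real eigenvalues. Let $C\in\dot{\mathcal H}^{N}_{\mathcal J}$ if $N$ is even, or $C\in\dot{\mathcal H}^{N-1}_{\mathcal J}$ if $N$ is odd. Then there exist $S\in\dot{\mathcal T}_{\mathcal J}$ and an $N\times N$ permutation matrix $P$ such that $$S^{*}CS=\begin{cases}\mathcal P\,P^tJ_{N}P & \text{if } N \text{ is even},\\ \mathcal P\,P^tJ_{(N,N-1)}P&\text{if } N\text{ is odd}.\end{cases}$$
   Context: Here $\lambda_i\in\mathbb R$, $N=n_1+\dots+n_p$, and $\mathcal J_n(\lambda)$ is the $n\times n$ upper Jordan block. All $N\times N$ matrices $C=[C_{ij}]_{i,j=1}^p$ are partitioned into blocks $C_{ij}\in \mathrm M(n_i\times n_j,\mathbb R)$. A block $C_{ij}$ is upper Toeplitz if $C_{ij}=(0\mid T)$ when $n_i\le n_j$, or $C_{ij}=\begin{pmatrix}T\\0\end{pmatrix}$ when $n_j\le n_i$, where $T$ is an upper triangular Toeplitz square matrix of size $\min(n_i,n_j)$. $C$ is $N$-upper Toeplitz if every block is upper Toeplitz. Let $I^{\pm}_{n}=\mathrm{diag}(1,-1,1,\dots)\in \mathrm M(n\times n,\mathbb R)$ and $I^\pm=I^{\pm}_{n_1}\oplus\cdots\oplus I^\pm_{n_p}$; $C$ is $N$-upper alternating Toeplitz if $C=I^\pm C'$ with $C'$ $N$-upper Toeplitz. Let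 $\mathcal P=\mathcal P_{n_1}\oplus\cdots\oplus\mathcal P_{n_p}$, where $\mathcal P_n$ is the $n\times n$ matrix with ones on the antidiagonal and zeros elsewhere. Define $C^{*}=\mathcal P C^t\mathcal P$ (the $N$-block star); $C$ is $N$-skew-symmetric if $C^*=-C$. $\dot{\mathcal T}_{\mathcal J}$ is the set of invertible real $N$-upper Toeplitz matrices $[A_{ij}]$ with $A_{ij}=0$ whenever $\lambda_i\ne\lambda_j$. $\dot{\mathcal H}^K_{\mathcal J}$ is the set of real $N$-skew-symmetric, $N$-upper alternating Toeplitz matrices $[B_{ij}]$ of rank $K$ with $B_{ij}=0$ whenever $\lambda_i\neq-\lambda_j$. For $R=2r$, $J_R=\begin{pmatrix}0&I_r\\-I_r&0\end{pmatrix}$ and $J_{(N,R)}=\begin{pmatrix}J_R&0\\0&0\end{pmatrix}\in \mathrm M(N\times N,\mathbb R)$. *)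

(* Defs.v *)
From mathcomp Require Import all_boot all_order all_algebra.
From mathcomp Require Export reals.

Set Implicit Arguments.
Unset Strict Implicit.
Unset Printing Implicit Defensive.

Import Order.TTheory GRing.Theory Num.Theory.
Local Open Scope ring_scope.

(* A Jordan matrix J = J_(n 0)(lam 0) (+) ... (+) J_(n p.-1)(lam p.-1) enters
   the definitions below only through its block sizes n : 'I_p -> nat and its
   eigenvalues lam : 'I_p -> R.  An N x N matrix with N = \sum_i n i has blocks
   submxblock C i j : 'M_(n i, n j). *)

Section Toeplitz.
Variable R : realType.

(* is_trig_mx is lower triangularity, hence the transpose. *)
Definition upper_toeplitz_sq k (T : 'M[R]_k) : Prop :=
  is_trig_mx T^T /\
  (forall i j i' j' : 'I_k, (j + i' = j' + i)%N -> T i j = T i' j').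

(* The existence of the equations e expresses m <= n, respectively n <= m. *)
Definition upper_toeplitz_block m n (C : 'M[R]_(m, n)) : Prop :=
  (exists (e : (n - m + m = n)%N) (T : 'M[R]_m),
     upper_toeplitz_sq T /\ C = castmx (erefl m, e) (row_mx 0 T)) \/
  (exists (e : (n + (m - n) = m)%N) (T : 'M[R]_n),
     upper_toeplitz_sq T /\ C = castmx (e, erefl n) (col_mx T 0)).

Definition alt_block k : 'M[R]_k := diag_mx (\row_(j < k) (-1) ^+ j).

Definition antidiag_block k : 'M[R]_k :=
  \matrix_(i, j) (j == rev_ord i)%:R.

Section Blocks.
Variables (p : nat) (n : 'I_p -> nat).

Definition upper_toeplitz (C : 'M[R]_(\sum_i n i)) : Prop :=
  forall i j, upper_toeplitz_block (submxblock C i j).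

Definition alt_mx : 'M[R]_(\sum_i n i) := \mxdiag_i alt_block (n i).

Definition upper_alt_toeplitz (C : 'M[R]_(\sum_i n i)) : Prop :=
  exists2 C', upper_toeplitz C' & C = alt_mx *m C'.

Definition antidiag_mx : 'M[R]_(\sum_i n i) :=
  \mxdiag_i antidiag_block (n i).

Definition block_star (C : 'M[R]_(\sum_i n i)) : 'M[R]_(\sum_i n i) :=
  antidiag_mx *m C^T *m antidiag_mx.

Definition block_skew (C : 'M[R]_(\sum_i n i)) : Prop := block_star C = - C.

Variable lam : 'I_p -> R.

Definition T_dot (A : 'M[R]_(\sum_i n i)) : Prop :=
  [/\ A \in unitmx, upper_toeplitz A
    & forall i j, lam i <> lam j -> submxblock A i j = 0].

Definition H_dot (K : nat) (B : 'M[R]_(\sum_i n i)) : Prop :=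
  [/\ block_skew B, upper_alt_toeplitz B, \rank B = K
    & forall i j, lam i <> - lam j -> submxblock B i j = 0].

End Blocks.

(* In the next two definitions conform_mx only transports along equal
   dimensions: for r even, r./2 + r./2 = r, and for r <= N, r + (N - r) = N.
   Outside these cases the result is the irrelevant default 0. *)
Definition sympl_mx (r : nat) : 'M[R]_r :=
  conform_mx 0 (block_mx 0 1%:M (- 1%:M) 0 : 'M[R]_(r./2 + r./2)).

Definition sympl_pad_mx (N r : nat) : 'M[R]_N :=
  conform_mx 0 (block_mx (sympl_mx r) 0 0 0 : 'M[R]_(r + (N - r))).

End Toeplitz.

Arguments antidiag_mx {R p} n.
Arguments sympl_mx {R} r.
Arguments sympl_pad_mx {R} N r.

(* Main.v *)
Require Import Defs.
From mathcomp Require Import all_boot all_order all_algebra.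
From mathcomp Require Import perm ring lra zify.

Set Implicit Arguments.
Unset Strict Implicit.
Unset Printing Implicit Defensive.

Import Order.TTheory GRing.Theory Num.Theory.
Local Open Scope ring_scope.

(** Write W for the block antidiagonal matrix, X for the nilpotent part of the
    Jordan matrix and L for its diagonal part.  Put G = W C.  That C is skew
    for the block star says that G is skew-symmetric; that C is alternating
    Toeplitz and that its blocks vanish unless lam i = - lam j says that X and
    L are skew-adjoint for G ([form_mx_shift], [form_mx_eigen]).  An upper
    Toeplitz matrix is one that commutes with X ([upper_toeplitzP]), so S must
    be an invertible matrix commuting with X and L; equivalently, its columns
    are X^k e_i, where (e_i) is a family of generators for the Jordan blocks,
    with the same sizes and eigenvalues as the standard one ([adapted]).  As
    block_star S *m C *m S = W (S^T G S), the theorem asks for generators for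
    which the Gram matrix of the vectors X^k e_i is P^T J P.  A skew-symmetric
    matrix is of that form as soon as its nonzero entries are 1 or -1, at most
    one in each row, and the rank then tells how many rows vanish
    ([skew_signed_matching]).

    Let D be the bilinear form of G.  The Gram matrix is given by the numbers
    f_ij(k) = D(e_i, X^k e_j), which vanish for k >= min(n_i, n_j), and the
    orthogonal splitting is the usual one for Hermitian forms over a local ring,
    here the power series in x with the involution x -> -x.  If
    f_ij(n_i - 1) is nonzero for some i, j with n_i = n_j, then one or two
    blocks are made into a standard pair by changes e_i -> e_i + t X^s e_j that
    clear the f(k) one at a time, from high k to low ([normalize_single],
    [normalize_pair]); the span of these blocks is nondegenerate, and the
    remaining generators are projected to its orthogonal complement.  The
    projection respects the block sizes and the eigenvalues, so that it yields
    a new family of generators ([split_pair]).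

    When no such i, j is left, the radical, which has dimension at most 1,
    leaves little room.  Let e_i be a largest remaining block.  Its socle
    X^(n_i - 1) e_i lies in the radical, hence spans it.  If e_i is not alone,
    the second largest block e_l has n_l = n_i - 1 and pairs perfectly with the
    image of e_i modulo the radical, and a third block would produce one more
    radical vector ([second_size], [no_third]).  The one or two remaining
    blocks are then normalized by the same elementary changes as before
    ([residual]). *)

(** * Skew-adjoint operators and families of generators *)

Section SkewForm.
Variables (R : rcfType) (V : lmodType R) (X L : {linear V -> V}).
Variables (p : nat) (n : 'I_p -> nat) (lam : 'I_p -> R).
Variable D : V -> V -> R.

Implicit Types (e : 'I_p -> V) (Q A : {set 'I_p}) (u v w : V).

Local Notation pow k v := (iter k X v).

(** The X-stable subspace generated by the [e i] with [i] in [A], without any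
    mention of polynomials in X. *)
Inductive gen_by A e : V -> Prop :=
| gen_by0 : gen_by A e 0
| gen_by_base i : i \in A -> gen_by A e (e i)
| gen_by_add u v : gen_by A e u -> gen_by A e v -> gen_by A e (u + v)
| gen_by_scale (c : R) u : gen_by A e u -> gen_by A e (c *: u)
| gen_by_shift u : gen_by A e u -> gen_by A e (X u).

(** Generators of a Jordan decomposition of V with block sizes [n] and
    eigenvalues [lam].  Independence of the vectors X^k e_i, k < n i, is not
    part of the definition: in dimension sum_i n i it follows by counting. *)
Definition adapted e : Prop :=
  [/\ forall i, pow (n i) (e i) = 0, forall i, L (e i) = lam i *: e i
    & forall v, gen_by [set: 'I_p] e v].

Definition gram e i j k : R := D (e i) (pow k (e j)).

(** Every X^a e_i pairs with at most one X^b e_j, with value 1 or -1: the one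
    with [j = s] and [a + b + 1 = m].  The value [m = 0] allows [e i] to be
    orthogonal to everything. *)
Definition monomial_at e i : Prop := exists s m (c : R),
  c ^+ 2 = 1 /\ forall j k, gram e i j k = c * ((j == s) && (k.+1 == m))%:R.

(** The blocks in [Q] are in final form and orthogonal to the others.  The
    proof enlarges [Q] until it contains every block. *)
Definition split_off e Q : Prop :=
  [/\ adapted e, forall i j k, i \in Q -> j \notin Q -> gram e i j k = 0
    & forall i, i \in Q -> monomial_at e i].

Definition replace e a v : 'I_p -> V := fun i => if i == a then v else e i.

Hypothesis D_linl : forall a u v w, D (a *: u + v) w = a * D u w + D v w.
Hypothesis D_skew : forall u v, D u v = - D v u.
Hypothesis D_X : forall u v, D (X u) v = - D u (X v).
Hypothesis D_L : forall u v, D (L u) v = - D u (L v).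
Hypothesis L_X : forall v, L (X v) = X (L v).

Lemma powD k u v : pow k (u + v) = pow k u + pow k v.
Proof. by elim: k => //= k ->; rewrite linearD. Qed.

Lemma powZ k (c : R) u : pow k (c *: u) = c *: pow k u.
Proof. by elim: k => //= k ->; rewrite linearZ. Qed.

Lemma powN k u : pow k (- u) = - pow k u.
Proof. by rewrite -scaleN1r powZ scaleN1r. Qed.

Lemma pow0 k : pow k 0 = 0.
Proof. by elim: k => //= k ->; rewrite linear0. Qed.

Lemma pow_ge e i k : adapted e -> (n i <= k)%N -> pow k (e i) = 0.
Proof. by case=> he _ _ /subnK <-; rewrite iterD he pow0. Qed.

Lemma L_pow k v : L (pow k v) = pow k (L v).
Proof. by elim: k => //= k <-; rewrite L_X. Qed.

Lemma D0l w : D 0 w = 0.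
Proof.
have := D_linl 1 0 0 w; rewrite scaler0 addr0 mul1r => h.
by apply: (addrI (D 0 w)); rewrite addr0 -h.
Qed.

Lemma DDl u v w : D (u + v) w = D u w + D v w.
Proof. by rewrite -{1}[u]scale1r D_linl mul1r. Qed.

Lemma DZl c u w : D (c *: u) w = c * D u w.
Proof. by rewrite -[c *: u]addr0 D_linl D0l addr0. Qed.

Lemma DNl u w : D (- u) w = - D u w.
Proof. by rewrite -scaleN1r DZl mulN1r. Qed.

Lemma D0r w : D w 0 = 0.
Proof. by rewrite D_skew D0l oppr0. Qed.

Lemma DDr u v w : D w (u + v) = D w u + D w v.
Proof. by rewrite D_skew DDl opprD -!D_skew. Qed.

Lemma DZr c u w : D w (c *: u) = c * D w u.
Proof. by rewrite D_skew DZl -mulrN -D_skew. Qed.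

Lemma DNr u w : D w (- u) = - D w u.
Proof. by rewrite -scaleN1r DZr mulN1r. Qed.

Lemma D_suml (I : finType) (P : pred I) (F : I -> V) w :
  D (\sum_(i | P i) F i) w = \sum_(i | P i) D (F i) w.
Proof. by apply: (big_morph (D^~ w)) => [u v|]; rewrite ?DDl ?D0l. Qed.

Lemma D_powl k u v : D (pow k u) v = (-1) ^+ k * D u (pow k v).
Proof.
elim: k u v => [|k IH] u v; first by rewrite mul1r.
by rewrite iterS D_X IH -iterSr exprS mulN1r mulNr.
Qed.

Lemma D_pow_sym k u v : D u (pow k v) = - (-1) ^+ k * D v (pow k u).
Proof. by rewrite D_skew D_powl mulNr. Qed.

(** X^k is self-adjoint for even k, whence a skew form vanishes on (u, X^k u). *)
Lemma D_self_even k u : ~~ odd k -> D u (pow k u) = 0.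
Proof.
move=> ev; have := D_pow_sym k u u; rewrite -signr_odd (negbTE ev).
by move=> h; lra.
Qed.

(** Eigenspaces of the skew-adjoint L pair nontrivially only for opposite
    eigenvalues. *)
Lemma D_eigen u v k (a b : R) : L u = a *: u -> L v = b *: v ->
  D u (pow k v) != 0 -> a = - b.
Proof.
move=> hu hv nz; have := D_L u (pow k v).
rewrite hu L_pow hv powZ DZl DZr => /eqP; rewrite -subr_eq0 opprK -mulrDl.
by rewrite mulf_eq0 (negbTE nz) orbF addr_eq0 => /eqP.
Qed.

Lemma gram_ge e i j k : adapted e -> (n j <= k)%N -> gram e i j k = 0.
Proof. by move=> he h; rewrite /gram (pow_ge he h) D0r. Qed.

Lemma gram_sym e i j k : gram e i j k = - (-1) ^+ k * gram e j i k.
Proof. exact: D_pow_sym. Qed.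

Lemma gram_sym0 e i j k : gram e j i k = 0 -> gram e i j k = 0.
Proof. by rewrite (gram_sym e i j) => ->; rewrite mulr0. Qed.

Lemma gram_gel e i j k : adapted e -> (n i <= k)%N -> gram e i j k = 0.
Proof. by move=> he h; apply: gram_sym0; apply: gram_ge. Qed.

Lemma gram_eigen e i j k : adapted e -> gram e i j k != 0 -> lam i = - lam j.
Proof. by move=> [_ hL _]; apply: D_eigen. Qed.

Lemma gen_by_opp A e u : gen_by A e u -> gen_by A e (- u).
Proof. by rewrite -scaleN1r; apply: gen_by_scale. Qed.

Lemma gen_by_pow A e k u : gen_by A e u -> gen_by A e (pow k u).
Proof. by move=> h; elim: k => //= k; apply: gen_by_shift. Qed.

Lemma gen_by_sum A e (I : finType) (F : I -> V) :
  (forall i, gen_by A e (F i)) -> gen_by A e (\sum_i F i).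
Proof.
move=> h; elim/big_ind: _ => //; [exact: gen_by0 | exact: gen_by_add].
Qed.

Lemma gen_by_trans A B e e' v : (forall i, i \in A -> gen_by B e' (e i)) ->
  gen_by A e v -> gen_by B e' v.
Proof.
move=> h; elim=> {v}.
- exact: gen_by0.
- exact: h.
- by move=> u v _ hu _ hv; apply: gen_by_add.
- by move=> c u _ hu; apply: gen_by_scale.
- by move=> u _ hu; apply: gen_by_shift.
Qed.

Lemma D_gen_by0 A e u v : (forall j k, j \in A -> D u (pow k (e j)) = 0) ->
  gen_by A e v -> forall k, D u (pow k v) = 0.
Proof.
move=> h; elim=> {v}.
- by move=> k; rewrite pow0 D0r.
- by move=> i iA k; apply: h.
- by move=> v w _ hv _ hw k; rewrite powD DDr hv hw addr0.
- by move=> c v _ hv k; rewrite powZ DZr hv mulr0.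
- by move=> v _ hv k; rewrite -iterSr hv.
Qed.

(** Changing the generators outside [Q] within the span of the blocks outside
    [Q] is harmless: this span is orthogonal to the blocks in [Q]. *)
Lemma split_off_ext e e' Q : split_off e Q -> adapted e' ->
  (forall i, i \in Q -> e' i = e i) ->
  (forall j, j \notin Q -> gen_by (~: Q) e (e' j)) -> split_off e' Q.
Proof.
move=> [he orth mono] he' eqQ genQ.
have orth' i j k : i \in Q -> j \notin Q -> gram e' i j k = 0.
  move=> iQ jQ; rewrite /gram eqQ //; apply: (D_gen_by0 (A := ~: Q) (e := e)).
    by move=> l r; rewrite inE => lQ; apply: orth.
  exact: genQ.
split=> // i iQ; have [s [m [c [c2 h]]]] := mono i iQ.
exists s, m, c; split=> // j k; rewrite -h.
case: (boolP (j \in Q)) => jQ; first by rewrite /gram !eqQ.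
by rewrite orth' // orth.
Qed.

(** An elementary change of generators.  It can be undone, which is obvious for
    [a <> b]; for [a = b] it multiplies e_a by c + t X^s, which is invertible
    because X is nilpotent.  The last hypothesis says that the new vector is
    killed by X^(n a) and stays in the same eigenspace of L. *)
Lemma adapted_replace e a b c t s : adapted e -> c != 0 ->
  (a = b -> (0 < s)%N) -> (t != 0 -> lam a = lam b /\ (n b <= n a + s)%N) ->
  adapted (replace e a (c *: e a + t *: pow s (e b))).
Proof.
move=> he c0 hab ht; have [hX hL hgen] := he.
set e' := replace _ _ _.
have e'a : e' a = c *: e a + t *: pow s (e b) by rewrite /e' /replace eqxx.
have e'N i : i != a -> e' i = e i by rewrite /e' /replace => /negbTE ->.
split.
- move=> i; have [->|ia] := eqVneq i a; last by rewrite e'N.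
  rewrite e'a powD !powZ hX scaler0 add0r -iterD.
  have [->|t0] := eqVneq t 0; first by rewrite scale0r.
  by rewrite (pow_ge he) ?scaler0 //; case: (ht t0).
- move=> i; have [->|ia] := eqVneq i a; last by rewrite e'N.
  rewrite e'a linearD !linearZ /= L_pow !hL powZ scalerDr !scalerA mulrC.
  have [->|t0] := eqVneq t 0; first by rewrite mul0r mulr0.
  by have [-> _] := ht t0; rewrite (mulrC t).
- move=> v; apply: gen_by_trans (hgen v) => i _.
  have gb j : gen_by setT e' (e' j) by apply: gen_by_base; rewrite inE.
  have [->|ia] := eqVneq i a; last by rewrite -e'N.
  have eqa k : pow k (e a) = c^-1 *: (pow k (e' a) - t *: pow (k + s) (e b)).
    by rewrite e'a powD !powZ -iterD addrK scalerA mulVf // scale1r.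
  have [eab|ab] := eqVneq b a; last first.
    rewrite -[e a]/(pow 0 (e a)) eqa; apply/gen_by_scale/gen_by_add; first exact: gb.
    by apply/gen_by_opp/gen_by_scale/gen_by_pow; rewrite -e'N.
  (* X^k e_a = c^-1 (X^k e'_a - t X^(k + s) e_a), and X^k e_a = 0 for large k *)
  suff H d k : (n a <= k + d)%N -> gen_by setT e' (pow k (e a)).
    by apply: (H (n a) 0%N).
  elim: d k => [|d IH] k hk.
    by rewrite (pow_ge he); [exact: gen_by0 | rewrite -[k]addn0].
  rewrite eqa; apply/gen_by_scale/gen_by_add; first exact: gen_by_pow.
  apply/gen_by_opp/gen_by_scale; rewrite eab; apply: IH.
  by have := hab (esym eab); lia.
Qed.

Lemma split_off_replace e Q a b c t s : split_off e Q ->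
  a \notin Q -> b \notin Q -> c != 0 ->
  (a = b -> (0 < s)%N) -> (t != 0 -> lam a = lam b /\ (n b <= n a + s)%N) ->
  split_off (replace e a (c *: e a + t *: pow s (e b))) Q.
Proof.
move=> hs aQ bQ c0 hab ht; have [he _ _] := hs.
apply: split_off_ext (hs) _ _ _; first exact: adapted_replace.
- by move=> i iQ; rewrite /replace; case: eqP iQ aQ => // -> ->.
- have gb i : i \notin Q -> gen_by (~: Q) e (e i).
    by move=> iQ; apply: gen_by_base; rewrite inE.
  move=> j jQ; rewrite /replace; case: eqP => _; last exact: gb.
  by apply: gen_by_add; apply: gen_by_scale; [|apply: gen_by_pow]; apply: gb.
Qed.

(** * Normalizing one or two blocks *)

Lemma D_self_comb c t s k u v :
  D (c *: u + t *: pow s v) (pow k (c *: u + t *: pow s v)) =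
  c ^+ 2 * D u (pow k u) + c * t * D u (pow (k + s) v)
  + (-1) ^+ s * (c * t * D v (pow (k + s) u) + t ^+ 2 * D v (pow (k + s + s) v)).
Proof.
rewrite powD !powZ -iterD DDl !DZl !DDr !DZr !D_powl -!iterD addnA (addnC s k).
by ring.
Qed.

Lemma replace_eq e a v : replace e a v a = v.
Proof. by rewrite /replace eqxx. Qed.

Lemma replace_neq e a v i : i != a -> replace e a v i = e i.
Proof. by rewrite /replace => /negbTE ->. Qed.

(** Completing the square in R[[x]]: with s = m - k, the change
    e_a -> e_a + t X^s e_a adds 2 t f(m) to f(k) = D(e_a, X^k e_a) and leaves
    f above k alone, so the f(k) are cleared from the top down.  Here m is odd,
    because f vanishes at even arguments; so s is even when f(k) needs
    clearing, and the two cross terms agree in sign. *)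
Lemma clear_single e Q a m : split_off e Q -> a \notin Q ->
  gram e a a m != 0 -> (forall k, (m < k)%N -> gram e a a k = 0) ->
  exists e', [/\ split_off e' Q, forall i, i != a -> e' i = e i,
    gram e' a a m != 0 & forall k, k != m -> gram e' a a k = 0].
Proof.
move=> hs aQ top low.
have odd_m : odd m by apply: contraNT top => /D_self_even h; rewrite /gram h.
suff H r : (r <= m)%N -> exists e', [/\ split_off e' Q,
    forall i, i != a -> e' i = e i, gram e' a a m != 0
    & forall k, (m - r <= k)%N -> k != m -> gram e' a a k = 0].
  have [e' [h1 h2 h3 h4]] := H m (leqnn m).
  by exists e'; split=> // k; apply: h4; rewrite subnn.
elim: r => [|r IH] rm.
  by exists e; split=> // k; rewrite subn0 => mk km; apply: low; lia.
have [e' [hs' off top' low']] := IH (ltnW rm).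
have [ev|od] := boolP (~~ odd (m - r.+1)).
  exists e'; split=> // k hk km.
  have [->|kr] := eqVneq k (m - r.+1)%N; first exact: D_self_even.
  by apply: low' => //; lia.
have ev_s : (-1) ^+ r.+1 = 1 :> R.
  by rewrite -signr_odd (_ : odd r.+1 = false) //; move: od; lia.
pose t := - gram e' a a (m - r.+1) / (2 * gram e' a a m).
exists (replace e' a (1 *: e' a + t *: pow r.+1 (e' a))); split.
- by apply: split_off_replace; rewrite ?oner_eq0 // => _; split=> //; apply: leq_addr.
- by move=> i ia; rewrite replace_neq // off.
- rewrite /gram replace_eq D_self_comb ev_s -!/(gram _ _ _ _).
  rewrite !(low' (_ + _)%N) ?mulr0 ?addr0 ?expr1n ?mul1r ?addr0 //; lia.
- move=> k hk km; rewrite /gram replace_eq D_self_comb ev_s -!/(gram _ _ _ _).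
  rewrite (low' (_ + _ + _)%N); [|lia..].
  have [->|kr] := eqVneq k (m - r.+1)%N.
    by rewrite subnK // /t; field.
  by rewrite (low' k) ?(low' (k + _)%N); [ring|lia..].
Qed.

(** Only the sign of f(m) survives rescaling over the reals. *)
Lemma normalize_single e Q a m : split_off e Q -> a \notin Q ->
  gram e a a m != 0 -> (forall k, (m < k)%N -> gram e a a k = 0) ->
  exists e' c, [/\ split_off e' Q, forall i, i != a -> e' i = e i,
    c ^+ 2 = 1 & forall k, gram e' a a k = c * (k == m)%:R].
Proof.
move=> hs aQ top low.
have [{hs top low}e' [hs off top low]] := clear_single hs aQ top low.
have n0 : `|gram e' a a m| != 0 by rewrite normr_eq0.
pose c := (Num.sqrt `|gram e' a a m|)^-1.
have c2 : c ^+ 2 = `|gram e' a a m|^-1 by rewrite exprVn sqr_sqrtr.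
exists (replace e' a (c *: e' a + 0 *: pow 1 (e' a))), (Num.sg (gram e' a a m)).
split.
- apply: split_off_replace; rewrite ?eqxx //.
  by rewrite invr_eq0 sqrtr_eq0 normr_le0.
- by move=> i ia; rewrite replace_neq // off.
- by rewrite sqr_sg top.
- move=> k; rewrite /gram replace_eq D_self_comb c2 -!/(gram _ _ _ _).
  have [->|km] := eqVneq k m; last by rewrite (low k) //= mulr0n; ring.
  rewrite mulr1n sgr_def top; case: ltrgt0P top => // h _ /=; field; lra.
Qed.

(** Making the block of [a] isotropic by means of a block [b] that pairs
    perfectly with it: with s = m - k, the change e_a -> e_a + t X^s e_b adds
    2 t f_ab(m) to f_aa(k).  The bounds on the sizes say that X^s e_b is killed
    by X^(n a); s = 0 occurs only if f_aa(m) needs clearing, hence the form of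
    the first bound. *)
Lemma clear_diagonal e Q a b m : split_off e Q -> a \notin Q -> b \notin Q ->
  a != b -> gram e a b m != 0 ->
  (forall k, (m < k)%N -> gram e a b k = 0) ->
  (forall k, (m < k)%N -> gram e a a k = 0) ->
  (forall k, (m <= k)%N -> gram e b b k = 0) ->
  (gram e a a m != 0 -> (n b <= n a)%N) -> (n b <= (n a).+1)%N ->
  exists e', [/\ split_off e' Q, forall i, i != a -> e' i = e i,
    forall k, (m <= k)%N -> gram e' a b k = gram e a b k
    & forall k, gram e' a a k = 0].
Proof.
move=> hs aQ bQ ab top lowab lowa lowb na_nb nb_na1.
suff H r : (r <= m.+1)%N -> exists e', [/\ split_off e' Q,
    forall i, i != a -> e' i = e i,
    forall k, (m <= k)%N -> gram e' a b k = gram e a b k,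
    r = 0%N -> e' = e
    & forall k, (m.+1 - r <= k)%N -> gram e' a a k = 0].
  have [e' [h1 h2 h3 _ h4]] := H m.+1 (leqnn _).
  by exists e'; split=> // k; apply: h4; rewrite subnn.
elim: r => [|r IH] rm.
  by exists e; split=> // k; rewrite subn0; apply: lowa.
have [e' [hs' off keep he0 low']] := IH (ltnW rm).
have eb : e' b = e b by rewrite off // eq_sym.
set k0 := (m - r)%N.
have [z|nz] := eqVneq (gram e' a a k0) 0.
  exists e'; split=> // k hk; have [->//|kr] := eqVneq k k0.
  by apply: low'; rewrite /k0 in kr *; lia.
have od : odd k0 by apply: contraNT nz => /D_self_even h; rewrite /gram h.
have [he' _ _] := hs'.
(* A nonzero f_aa forces lam a = - lam a, and a nonzero f_ab then lam b = 0. *)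
have [la lb] : lam a = 0 /\ lam b = 0.
  have h1 := gram_eigen he' nz; have la : lam a = 0 by lra.
  have : gram e' a b m != 0 by rewrite keep.
  by move/(gram_eigen he'); rewrite la => h; split=> //; lra.
have topE : gram e' a b m = gram e a b m by apply: keep.
have lowbb k : (m <= k)%N -> gram e' b b k = 0.
  by move=> mk; rewrite /gram eb; apply: lowb.
have lowab' k : (m < k)%N -> gram e' a b k = 0.
  by move=> mk; rewrite keep ?lowab // ltnW.
pose t := - gram e' a a k0 / (2 * gram e' a b m).
exists (replace e' a (1 *: e' a + t *: pow r (e' b))); split=> //.
- apply: split_off_replace; rewrite ?oner_eq0 //.
    by move=> /eqP; rewrite (negbTE ab).
  move=> _; split; first by rewrite la lb.
  case: (posnP r) => [r0|]; last by lia.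
  rewrite r0 addn0; apply: na_nb.
  by move: nz; rewrite he0 // /k0 r0 subn0.
- by move=> i ia; rewrite replace_neq // off.
- move=> k mk; rewrite /gram replace_eq (@replace_neq _ a _ b) 1?eq_sym //.
  rewrite DDl !DZl D_powl -iterD -!/(gram _ _ _ _) mul1r keep //.
  by rewrite lowbb ?mulr0 ?addr0 //; lia.
- move=> k hk; rewrite /gram replace_eq D_self_comb -!/(gram _ _ _ _).
  rewrite lowbb; [|rewrite /k0 in od; lia].
  rewrite (gram_sym e' b a).
  have sgn : - (-1) ^+ (k0 + r) * (-1) ^+ r = 1 :> R.
    by rewrite mulNr -exprD -addnA addnn -signr_odd oddD odd_double od addbF /=; ring.
  have [->|kr] := eqVneq k k0.
    have km : (k0 + r = m)%N by rewrite /k0; lia.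
    rewrite -km in topE *; transitivity (gram e' a a k0
        + t * gram e' a b (k0 + r) * (1 + - (-1) ^+ (k0 + r) * (-1) ^+ r)).
      by ring.
    by rewrite sgn /t -km; field; rewrite topE km.
  rewrite low' ?lowab'; [by ring|rewrite /k0 in kr; lia..].
Qed.

(** Multiplying e_b by a unit of R[[x]] so that the pairing of [a] with [b]
    becomes the standard one.  Isotropy of the block of [b] is a property of its
    span and is not affected. *)
Lemma dualize_pair e Q a b m : split_off e Q -> a \notin Q -> b \notin Q ->
  a != b -> gram e a b m != 0 ->
  (forall k, (m < k)%N -> gram e a b k = 0) ->
  (forall k, gram e b b k = 0) ->
  exists e', [/\ split_off e' Q, forall i, i != b -> e' i = e i,
    forall k, gram e' a b k = (k == m)%:R & forall k, gram e' b b k = 0].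
Proof.
move=> hs aQ bQ ab top lowab bb0.
suff H r : (r <= m)%N -> exists e', [/\ split_off e' Q,
    forall i, i != b -> e' i = e i, gram e' a b m = 1,
    forall k, (m - r <= k)%N -> k != m -> gram e' a b k = 0
    & forall k, gram e' b b k = 0].
  have [e' [h1 h2 h3 h4 h5]] := H m (leqnn m).
  exists e'; split=> // k; have [->//|km] := eqVneq k m.
  by apply: h4 => //; rewrite subnn.
have gE e1 c t s k : gram (replace e1 b (c *: e1 b + t *: pow s (e1 b))) a b k
    = c * gram e1 a b k + t * gram e1 a b (k + s).
  by rewrite /gram replace_eq replace_neq // powD !powZ DDr !DZr -iterD.
have gbE e1 c t s k : (forall k, gram e1 b b k = 0) ->
    gram (replace e1 b (c *: e1 b + t *: pow s (e1 b))) b b k = 0.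
  move=> h; rewrite /gram replace_eq D_self_comb -!/(gram _ _ _ _) !h; ring.
elim: r => [|r IH] rm.
  exists (replace e b ((gram e a b m)^-1 *: e b + 0 *: pow 1 (e b))); split.
  - by apply: split_off_replace; rewrite ?invr_eq0 ?eqxx.
  - by move=> i ib; rewrite replace_neq.
  - by rewrite gE mul0r addr0 mulVf.
  - by move=> k mk km; rewrite gE (lowab k) ?mulr0 ?mul0r ?addr0 //; lia.
  - by move=> k; apply: gbE.
have [e' [hs' off top' low' bb']] := IH (ltnW rm).
pose t := - gram e' a b (m - r.+1).
exists (replace e' b (1 *: e' b + t *: pow r.+1 (e' b))); split.
- by apply: split_off_replace; rewrite ?oner_eq0 // => _; split=> //; apply: leq_addr.
- by move=> i ib; rewrite replace_neq // off.
- by rewrite gE top' low' ?mulr0 ?addr0 ?mulr1 //; lia.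
- move=> k hk km; rewrite gE; have [->|kr] := eqVneq k (m - r.+1)%N.
    by rewrite subnK // top' /t; ring.
  by rewrite !low' ?mulr0 ?addr0 //; lia.
- by move=> k; apply: gbE.
Qed.

(** Used with [n a = n b] for a nondegenerate pair, and with [n a = n b + 1]
    for the pair that carries the radical. *)
Lemma normalize_pair e Q a b m : split_off e Q -> a \notin Q -> b \notin Q ->
  a != b -> gram e a b m != 0 ->
  (forall k, (m < k)%N -> gram e a b k = 0) ->
  (forall k, (m < k)%N -> gram e a a k = 0) ->
  (forall k, (m <= k)%N -> gram e b b k = 0) ->
  (gram e a a m != 0 -> (n b <= n a)%N) ->
  (n b <= (n a).+1)%N -> (n a <= (n b).+1)%N ->
  exists e', [/\ split_off e' Q, forall i, i != a -> i != b -> e' i = e i,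
    forall k, gram e' a b k = (k == m)%:R, forall k, gram e' a a k = 0
    & forall k, gram e' b b k = 0].
Proof.
move=> hs aQ bQ ab top lowab lowa lowb h1 h2 h3.
have [e1 [hs1 off1 keep1 aa1]] :=
  clear_diagonal hs aQ bQ ab top lowab lowa lowb h1 h2.
have e1b : e1 b = e b by rewrite off1 // eq_sym.
have lowb1 k : (m <= k)%N -> gram e1 b b k = 0.
  by move=> mk; rewrite /gram e1b; apply: lowb.
have ba : b != a by rewrite eq_sym.
have top1 : gram e1 b a m != 0.
  by rewrite gram_sym mulf_neq0 ?oppr_eq0 ?signr_eq0 // keep1.
have lowba1 k : (m < k)%N -> gram e1 b a k = 0.
  by move=> mk; apply: gram_sym0; rewrite keep1 ?lowab // ltnW.
have lowbb1 k : (m < k)%N -> gram e1 b b k = 0.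
  by move=> mk; apply: lowb1; apply: ltnW.
have na_nb1 : gram e1 b b m != 0 -> (n a <= n b)%N by rewrite lowb1 ?eqxx.
have [e2 [hs2 off2 keep2 bb2]] := clear_diagonal hs1 bQ aQ ba top1 lowba1
  lowbb1 (fun k _ => aa1 k) na_nb1 h3.
have e2a : e2 a = e1 a by rewrite off2.
have lowab2 k : (m <= k)%N -> gram e2 a b k = gram e a b k.
  by move=> mk; rewrite gram_sym keep2 // -gram_sym keep1.
have top2 : gram e2 a b m != 0 by rewrite lowab2.
have lowab3 k : (m < k)%N -> gram e2 a b k = 0.
  by move=> mk; rewrite lowab2 ?lowab // ltnW.
have [e3 [hs3 off3 ab3 bb3]] := dualize_pair hs2 aQ bQ ab top2 lowab3 bb2.
exists e3; split=> //.
- by move=> i ia ib; rewrite off3 // off2 // off1.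
- by move=> k; rewrite /gram off3 // e2a; apply: aa1.
Qed.

(** * Splitting off nondegenerate blocks *)

Lemma pow_sum k (I : finType) (F : I -> V) :
  pow k (\sum_i F i) = \sum_i pow k (F i).
Proof. exact: (big_morph (iter k X) (powD k) (pow0 k)). Qed.

Lemma D_pow_gram e i j r k :
  D (pow r (e i)) (pow k (e j)) = (-1) ^+ r * gram e i j (r + k).
Proof. by rewrite D_powl -iterD. Qed.

(** The component [w] of [v] along the block of [a] is read off from the pairings
    of [v] with the dual block of [b].  If X^r v = 0, the coefficient of
    X^k e_a in [w], a multiple of D(v, X^(m - k) e_b), vanishes unless
    m - k < r, whence X^r w = 0.  This is why projecting a generator keeps its
    block size. *)
Lemma project e a b m c v : adapted e -> (n a <= m.+1)%N -> (n b <= m.+1)%N ->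
  c != 0 -> (forall k, gram e a b k = c * (k == m)%:R) ->
  exists w, [/\ forall A, a \in A -> gen_by A e w,
    forall k, D (v - w) (pow k (e b)) = 0,
    forall r, pow r v = 0 -> pow r w = 0
    & forall mu : R, L v = mu *: v -> L w = mu *: w].
Proof.
move=> he na nb c0 hab; have [_ hL _] := he.
pose x k := c^-1 * (-1) ^+ k * D v (pow (m - k) (e b)).
exists (\sum_(k < m.+1) x k *: pow k (e a)); split.
- move=> A aA; apply: gen_by_sum => k.
  by apply/gen_by_scale/gen_by_pow/gen_by_base.
- move=> k; rewrite DDl DNl D_suml.
  have [km|mk] := leqP k m; last first.
    rewrite (pow_ge he) ?D0r ?(leq_trans nb) //.
    by rewrite big1 ?subrr // => i _; rewrite D0r.
  have mkm : (m - k < m.+1)%N by lia.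
  rewrite (bigD1 (Ordinal mkm)) //= big1 ?addr0 => [|i /eqP ik].
    rewrite DZl D_pow_gram hab subnK // eqxx mulr1 /x subKn //.
    have s2 : (-1) ^+ (m - k) * (-1) ^+ (m - k) = 1 :> R.
      by rewrite -expr2 sqrr_sign.
    rewrite [X in _ - X](_ : _ = (-1) ^+ (m - k) * (-1) ^+ (m - k) * (c^-1 * c)
      * D v (pow k (e b))); last by ring.
    by rewrite s2 mulVf // !mul1r subrr.
  rewrite DZl D_pow_gram hab (_ : (i + k == m)%N = false) ?mulr0 //.
  by apply/eqP => ikm; apply: ik; apply: val_inj => /=; lia.
- move=> r hr; rewrite pow_sum big1 // => i _; rewrite powZ -iterD.
  have [h|h] := leqP (n a) (r + i); first by rewrite (pow_ge he) ?scaler0.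
  have -> : x i = 0; last by rewrite scale0r.
  rewrite /x (_ : m - i = r + (m - i - r))%N; last by lia.
  by rewrite iterD D_pow_sym hr D0r !mulr0.
- move=> mu hv; have top : gram e a b m = c by rewrite hab eqxx mulr1.
  have la : lam a = - lam b by apply: (gram_eigen he (k := m)); rewrite top.
  rewrite linear_sum scaler_sumr; apply: eq_bigr => k _.
  rewrite linearZ /= L_pow hL powZ scalerA [mu *: _]scalerA mulrC.
  have [z|nz] := eqVneq (D v (pow (m - k) (e b))) 0.
    by rewrite /x z !mulr0.
  by rewrite la -(D_eigen hv (hL b) nz).
Qed.

Lemma absorb e Q a b : split_off e Q -> a \notin Q -> b \notin Q ->
  monomial_at e a -> monomial_at e b ->
  (forall j k, j \notin a |: (b |: Q) -> gram e a j k = 0 /\ gram e b j k = 0) ->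
  split_off e (a |: (b |: Q)).
Proof.
move=> [he orth mono] aQ bQ ha hb hj; split=> //.
- move=> i j k /setU1P[->|/setU1P[->|iQ]] jQ.
  + by case: (hj j k jQ).
  + by case: (hj j k jQ).
  + by apply: orth => //; apply: contra jQ; rewrite !in_setU1 => ->; rewrite !orbT.
- by move=> i; rewrite !in_setU1 => /or3P[/eqP->|/eqP->|/mono].
Qed.

Lemma split_off_orth e Q i j k : split_off e Q -> i \notin Q -> j \in Q ->
  gram e i j k = 0.
Proof. by case=> _ orth _ iQ jQ; apply/gram_sym0/orth. Qed.

Lemma monomial_at_only e a b m c : c ^+ 2 = 1 ->
  (forall k, gram e a b k = c * (k == m)%:R) ->
  (forall j k, j != b -> gram e a j k = 0) -> monomial_at e a.
Proof.
move=> c2 hab hj; exists b, m.+1, c; split=> // j k.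
have [->|jb] := eqVneq j b; first by rewrite hab eqSS.
by rewrite hj // mulr0.
Qed.

(** The case [a = b] is the one of a single block that is dual to itself. *)
Lemma split_pair e Q a b m c c' : split_off e Q -> a \notin Q -> b \notin Q ->
  n a = m.+1 -> n b = m.+1 -> c ^+ 2 = 1 -> c' ^+ 2 = 1 ->
  (forall k, gram e a b k = c * (k == m)%:R) ->
  (forall k, gram e b a k = c' * (k == m)%:R) ->
  (a != b -> forall k, gram e a a k = 0 /\ gram e b b k = 0) ->
  exists e', split_off e' (a |: (b |: Q)).
Proof.
move=> hs aQ bQ na nb c2 c2' hab hba hself; have [he _ _] := hs.
have [hX hL hgen] := he.
have sq0 (x : R) : x ^+ 2 = 1 -> x != 0.
  by apply: contra_eq_neq => ->; rewrite expr0n eq_sym oner_eq0.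
have c0 := sq0 _ c2; have c0' := sq0 _ c2'.
set Q' := a |: (b |: Q).
have H l : exists v, if l \in Q' then v = e l else
    [/\ pow (n l) v = 0, L v = lam l *: v, gen_by [set a; b] e (e l - v)
      & forall k, D (e a) (pow k v) = 0 /\ D (e b) (pow k v) = 0].
  case: (l \in Q'); first by exists (e l).
  have na1 : (n a <= m.+1)%N by rewrite na.
  have nb1 : (n b <= m.+1)%N by rewrite nb.
  have [w [gw dw nw lw]] := project (e l) he na1 nb1 c0 hab.
  have [w' [gw' dw' nw' lw']] := project (e l) he nb1 na1 c0' hba.
  have aab : a \in [set a; b] by rewrite !inE eqxx.
  have bab : b \in [set a; b] by rewrite !inE eqxx orbT.
  have dsym u i : (forall k, D u (pow k (e i)) = 0) ->
      forall k, D (e i) (pow k u) = 0.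
    by move=> h k; rewrite D_pow_sym h mulr0.
  have [ab|ab] := eqVneq a b.
    exists (e l - w); split.
    - by rewrite powD powN hX nw ?hX // subr0.
    - by rewrite linearB /= (lw _ (hL l)) hL scalerBr.
    - by rewrite opprB addrC subrK; apply: gw.
    - by move=> k; have := dsym _ _ dw k; rewrite ab.
  exists (e l - w - w'); split.
  - by rewrite !powD !powN hX nw ?hX // nw' ?hX // !subr0.
  - by rewrite !linearB /= (lw _ (hL l)) (lw' _ (hL l)) hL.
  - rewrite -addrA -opprD opprB addrC subrK.
    by apply: gen_by_add; [apply: gw | apply: gw'].
  - move=> k.
    have aa r : gram e a a r = 0 by case: (hself ab r).
    have bb r : gram e b b r = 0 by case: (hself ab r).
    have aw : D (e a) (pow k w) = 0.
      apply: D_gen_by0 (gw _ (set11 a)) (k) => j r.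
      by rewrite inE => /eqP->; apply: aa.
    have bw : D (e b) (pow k w') = 0.
      apply: D_gen_by0 (gw' _ (set11 b)) (k) => j r.
      by rewrite inE => /eqP->; apply: bb.
    split.
      by rewrite addrAC powD powN DDr DNr aw dsym // subr0.
    by rewrite powD powN DDr DNr bw dsym // subr0.
have [e' He'] := fin_all_exists H.
have eQ' i : i \in Q' -> e' i = e i by move=> iQ; have := He' i; rewrite iQ.
have aQ' : a \in Q' by rewrite !inE eqxx.
have bQ' : b \in Q' by rewrite !inE eqxx orbT.
have he' : adapted e'.
  split.
  - by move=> l; have := He' l; case: ifP => [_ ->|_ []].
  - by move=> l; have := He' l; case: ifP => [_ ->|_ []].
  - move=> v; apply: gen_by_trans (hgen v) => l _.
    have gb j : gen_by setT e' (e' j) by apply: gen_by_base; rewrite inE.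
    have := He' l; case: ifP => [_ <- //|_ [_ _ h _]].
    rewrite -[e l](subrK (e' l)); apply: gen_by_add => //.
    apply: gen_by_trans h => i; rewrite !inE => /orP[]/eqP->; rewrite -eQ' //.
have hs' : split_off e' Q.
  apply: split_off_ext (hs) he' _ _.
    by move=> i iQ; apply: eQ'; rewrite !inE iQ !orbT.
  have gb j : j \notin Q -> gen_by (~: Q) e (e j).
    by move=> jQ; apply: gen_by_base; rewrite inE.
  move=> j jQ; have := He' j; case: ifP => [_ -> |_ [_ _ h _]]; first exact: gb.
  rewrite -[e' j](subKr (e j)); apply: gen_by_add; first exact: gb.
  apply: gen_by_opp; apply: gen_by_trans h => i.
  by rewrite !inE => /orP[]/eqP->; apply: gb.
have far j k : j \notin Q' -> gram e' a j k = 0 /\ gram e' b j k = 0.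
  move=> jQ; rewrite /gram (eQ' a) // (eQ' b) //; have := He' j; rewrite (negbTE jQ).
  by case=> _ _ _ /(_ k).
have mono i s : i \in [set a; b] -> s \in [set a; b] ->
    (forall j k, j \in [set a; b] -> j != s -> gram e' i j k = 0) ->
    forall j k, j != s -> gram e' i j k = 0.
  move=> iab sab h j k js; have iQ : i \notin Q.
    by move: iab; rewrite !inE => /orP[]/eqP->.
  have [jQ'|jQ'] := boolP (j \in Q'); last first.
    by move: iab; rewrite !inE => /orP[]/eqP->; case: (far j k jQ').
  have [jQ|jQ] := boolP (j \in Q); first exact: split_off_orth hs' _ _.
  by apply: h => //; move: jQ'; rewrite !inE (negbTE jQ) orbF.
have gQ i j k : i \in [set a; b] -> j \in [set a; b] -> gram e' i j k = gram e i j k.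
  by rewrite !inE /gram => /orP[]/eqP-> /orP[]/eqP->; rewrite !eQ'.
have aab : a \in [set a; b] by rewrite !inE eqxx.
have bab : b \in [set a; b] by rewrite !inE eqxx orbT.
exists e'; apply: absorb => //.
- apply: (@monomial_at_only _ a b m c) => //; first by move=> k; rewrite gQ.
  apply: mono => // j k; rewrite !inE => /orP[]/eqP->; rewrite ?eqxx // => ab.
  by rewrite gQ //; case: (hself ab k).
- apply: (@monomial_at_only _ b a m c') => //; first by move=> k; rewrite gQ.
  apply: mono => // j k; rewrite !inE => /orP[]/eqP->; rewrite ?eqxx // => ab.
  by rewrite gQ //; rewrite eq_sym in ab; case: (hself ab k).
Qed.

Lemma monomial_single e Q a m c : split_off e Q -> c ^+ 2 = 1 ->
  (forall j, j \notin Q -> j = a) -> a \notin Q ->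
  (forall k, gram e a a k = c * (k == m)%:R) -> split_off e setT.
Proof.
move=> hs c2 Qa aQ aa.
have -> : setT = a |: (a |: Q).
  by apply/setP=> j; rewrite !inE; have [//|/Qa->] := boolP (j \in Q);
    rewrite ?orbT ?eqxx.
have ma : monomial_at e a.
  apply: monomial_at_only c2 aa _ => j k ja; apply: split_off_orth hs aQ _.
  by apply: contraR ja => /Qa->.
apply: absorb => // j k; rewrite !inE !negb_or => /and3P[ja _ /Qa jE].
by rewrite jE eqxx in ja.
Qed.

(** A nonzero top pairing f_ab(n_a - 1) between blocks of equal size spans, on
    one of a, b alone or on both together, a nondegenerate piece.  If f_aa or
    f_bb has a nonzero top value, that block alone splits off; otherwise the
    pair can be made isotropic. *)
Lemma split_step e Q a b : split_off e Q -> a \notin Q -> b \notin Q ->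
  (0 < n a)%N -> n a = n b -> gram e a b (n a).-1 != 0 ->
  exists e' Q', split_off e' Q' /\ Q \proper Q'.
Proof.
move=> hs aQ bQ na0 nab top; have [he _ _] := hs.
have grow x y : x \notin Q -> Q \proper x |: (y |: Q).
  move=> xQ; apply/properP; split; last by exists x; rewrite // !inE eqxx.
  by apply/subsetP => i iQ; rewrite !inE iQ !orbT.
have one x : x \notin Q -> n x = n a -> gram e x x (n a).-1 != 0 ->
    exists e' Q', split_off e' Q' /\ Q \proper Q'.
  move=> xQ nx topx.
  have low k : ((n a).-1 < k)%N -> gram e x x k = 0.
    by move=> mk; apply: gram_ge => //; rewrite nx; lia.
  have [e1 [c [hs1 _ c2 xx]]] := normalize_single hs xQ topx low.
  have nxm : n x = (n a).-1.+1 by rewrite nx prednK.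
  have self : x != x -> forall k, gram e1 x x k = 0 /\ gram e1 x x k = 0.
    by rewrite eqxx.
  have [e2 hs2] := split_pair hs1 xQ xQ nxm nxm c2 c2 xx xx self.
  by exists e2, (x |: (x |: Q)); split=> //; apply: grow.
have [aa|nz] := eqVneq (gram e a a (n a).-1) 0; last exact: one aQ _ nz.
have [bb|nz] := eqVneq (gram e b b (n a).-1) 0; last exact: one bQ _ nz.
have ab : a != b.
  by apply: contraNneq top => abE; rewrite -abE aa.
have ge i j k : n j = n a -> ((n a).-1 < k)%N -> gram e i j k = 0.
  by move=> nj mk; apply: gram_ge => //; rewrite nj; lia.
have lowb k : ((n a).-1 <= k)%N -> gram e b b k = 0.
  by rewrite leq_eqVlt => /orP[/eqP<-//|]; apply: ge.
have na1 : n a = (n a).-1.+1 by rewrite prednK.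
have nb1 : n b = (n a).-1.+1 by rewrite -nab.
have [e1 [hs1 _ ab1 aa1 bb1]] : exists e1, [/\ split_off e1 Q,
    forall i, i != a -> i != b -> e1 i = e i,
    forall k, gram e1 a b k = (k == (n a).-1)%:R, forall k, gram e1 a a k = 0
    & forall k, gram e1 b b k = 0].
  apply: normalize_pair => //; rewrite -?nab // => k;
    [exact: ge | exact: ge].
have ba1 k : gram e1 b a k = - (-1) ^+ (n a).-1 * (k == (n a).-1)%:R.
  rewrite gram_sym ab1; case: eqP => [->//|_].
  by rewrite !mulr0.
have ab1' k : gram e1 a b k = 1 * (k == (n a).-1)%:R by rewrite mul1r.
have c2 : (- (-1) ^+ (n a).-1) ^+ 2 = 1 :> R by rewrite sqrrN sqrr_sign.
have [e2 hs2] := split_pair hs1 aQ bQ na1 nb1 (expr1n _ 2) c2 ab1' ba1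
  (fun _ k => conj (aa1 k) (bb1 k)).
by exists e2, (a |: (b |: Q)); split=> //; apply: grow.
Qed.

(** * The degenerate remainder *)

Hypothesis n_gt0 : forall i, (0 < n i)%N.
(** The form has corank at most 1. *)
Hypothesis radical_line : forall u v,
  (forall w, D u w = 0) -> (forall w, D v w = 0) -> u != 0 ->
  exists c : R, v = c *: u.
(** The vectors X^k e_i, k < n i, are independent; true when V has dimension
    sum_i n i. *)
Hypothesis coordinates : forall e i k, adapted e -> (k < n i)%N ->
  exists phi : V -> R,
    (forall c u v, phi (c *: u + v) = c * phi u + phi v) /\
    (forall j l, (l < n j)%N ->
       phi (pow l (e j)) = ((j == i) && (l == k))%:R).

Lemma argmax_block (P : pred 'I_p) i0 : P i0 ->
  exists2 i, P i & forall j, P j -> (n j <= n i)%N.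
Proof. by move=> Pi0; have [i Pi imax] := arg_maxnP n Pi0; exists i. Qed.

(** In this section no block outside [Q] can be split off any more, and [i] is a
    largest block outside [Q]. *)
Section Residual.
Variables (e : 'I_p -> V) (Q : {set 'I_p}) (i : 'I_p).
Hypothesis hs : split_off e Q.
Hypothesis unsplittable : forall a b, a \notin Q -> b \notin Q -> n a = n b ->
  gram e a b (n a).-1 = 0.
Hypothesis iQ : i \notin Q.
Hypothesis imax : forall j, j \notin Q -> (n j <= n i)%N.

Let he : adapted e. Proof. by case: hs. Qed.

Local Notation socle l := (pow (n l).-1 (e l)).

Let lt_pred l : ((n l).-1 < n l)%N. Proof. by rewrite prednK. Qed.

Let D_powr0 v j : D v (e j) = D v (pow 0 (e j)). Proof. by []. Qed.

Lemma D_split r l j k : l \notin Q -> j \in Q ->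
  D (pow r (e l)) (pow k (e j)) = 0.
Proof.
by move=> lQ jQ; rewrite D_pow_gram (split_off_orth _ hs lQ jQ) mulr0.
Qed.

(** The socle of [l] cannot pair with a smaller block, which X^(n l - 1) kills,
    nor with one of the same size, as these would split off. *)
Lemma gram_top0 l j k : l \notin Q -> (j \notin Q -> (n j <= n l)%N) ->
  ((n l).-1 <= k)%N -> gram e l j k = 0.
Proof.
move=> lQ njl lk; have [jQ|jQ] := boolP (j \in Q).
  exact: split_off_orth hs lQ jQ.
have [nlk|knl] := leqP (n l) k; first exact: gram_gel.
have kE : k = (n l).-1 by apply/eqP; rewrite eqn_leq lk andbT -ltnS prednK.
have [nl|nl] := eqVneq (n l) (n j); first by rewrite kE; apply: unsplittable.
apply: gram_ge => //; apply: leq_trans lk; rewrite -ltnS prednK //.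
by rewrite ltn_neqAle eq_sym nl njl.
Qed.

Lemma socle_radical l : l \notin Q -> n l = n i ->
  forall j k, D (socle l) (pow k (e j)) = 0.
Proof.
move=> lQ nl j k; rewrite D_pow_gram gram_top0 ?mulr0 ?leq_addr //.
by rewrite nl; apply: imax.
Qed.

Lemma socle_neq0 : socle i != 0.
Proof.
have [phi [lin bas]] := coordinates he (lt_pred i).
apply/eqP => z; have := bas i _ (lt_pred i); rewrite z !eqxx.
have := lin 1 0 0; rewrite scaler0 addr0 mul1r => /eqP.
rewrite -subr_eq0 opprD addNKr oppr_eq0 => /eqP -> /eqP.
by rewrite eq_sym oner_eq0.
Qed.

(** The radical is spanned by the socle of the block [i], so no other basis
    vector X^k e_l can occur with coefficient 1 in a radical vector.  Two further
    terms suffice for all applications. *)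
Lemma radical_comb l k c1 l1 k1 c2 l2 k2 :
  (k < n l)%N -> (k1 < n l1)%N -> (k2 < n l2)%N ->
  (l, k) != (i, (n i).-1) -> (l, k) != (l1, k1) -> (l, k) != (l2, k2) ->
  ~ forall j r,
      D (c1 *: pow k1 (e l1) + (c2 *: pow k2 (e l2) + pow k (e l)))
        (pow r (e j)) = 0.
Proof.
move=> kl kl1 kl2 di d1 d2; set v := c1 *: _ + _ => radv.
have rad u : (forall j r, D u (pow r (e j)) = 0) -> forall w, D u w = 0.
  have [_ _ hgen] := he; move=> h w.
  by apply: (D_gen_by0 _ (hgen w) 0) => j r _; apply: h.
have [c vE] := radical_line (rad _ (socle_radical iQ erefl)) (rad _ radv) socle_neq0.
have [phi [lin bas]] := coordinates he kl.
have diff l' k' : (l, k) != (l', k') -> (l' == l) && (k' == k) = false.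
  by move=> /negbTE; rewrite xpair_eqE (eq_sym l) (eq_sym k).
have := lin c (socle i) 0; rewrite addr0 -vE bas ?diff // mulr0 add0r.
rewrite /v !lin !bas // (diff _ _ d1) (diff _ _ d2) !eqxx !mulr0 !add0r.
have := lin (-1) 0 0; rewrite scaler0 addr0 mulN1r addNr => -> /eqP.
by rewrite oner_eq0.
Qed.

Lemma radical_pow l k : (k < n l)%N -> (l, k) != (i, (n i).-1) ->
  ~ forall j r, D (pow k (e l)) (pow r (e j)) = 0.
Proof.
move=> kl di h; apply: (@radical_comb l k 0 i (n i).-1 0 i (n i).-1) => //.
by move=> j r; rewrite !scale0r !add0r.
Qed.

Lemma largest_gram0 j k : ((n i).-1 <= k)%N -> gram e i j k = 0.
Proof. by apply: gram_top0 => //; apply: imax. Qed.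

(** A single remaining block either is a line, namely the radical, or pairs with
    itself perfectly modulo its socle. *)
Lemma residual_single : (forall j, j \notin Q -> j = i) ->
  exists e', split_off e' setT.
Proof.
move=> onlyi; have [ni|ni] := leqP (n i) 1.
  have z j k : gram e i j k = 0 by apply: largest_gram0; case: (n i) ni => [|[]].
  exists e; have -> : setT = i |: (i |: Q).
    by apply/setP=> j; rewrite !inE; have [//|/onlyi->] := boolP (j \in Q);
      rewrite ?orbT ?eqxx.
  have mi : monomial_at e i.
    by exists i, 0%N, 1; rewrite expr1n; split=> // j k; rewrite z andbF mulr0.
  by apply: absorb.
have niE : n i = (n i).-2.+2 by rewrite !prednK // -ltnS prednK.
have top : gram e i i (n i).-2 != 0.
  apply/eqP => z; apply: (@radical_pow i (n i).-2).
    by rewrite [X in (_ < X)%N]niE.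
    by rewrite xpair_eqE eqxx {2}niE /= neq_ltn ltnSn.
  move=> j [|k]; rewrite D_pow_gram; last first.
    by rewrite largest_gram0 ?mulr0 // addnS niE /= ltnS leq_addr.
  rewrite addn0; have [jQ|/onlyi->] := boolP (j \in Q).
    by rewrite (split_off_orth _ hs iQ jQ) mulr0.
  by rewrite z mulr0.
have low k : ((n i).-2 < k)%N -> gram e i i k = 0.
  by move=> hk; apply: largest_gram0; rewrite niE.
have [e' [c [hs' _ c2 ii]]] := normalize_single hs iQ top low.
by exists e'; apply: monomial_single hs' c2 onlyi iQ ii.
Qed.

Variable l : 'I_p.
Hypothesis lQ : l \notin Q.
Hypothesis li : l != i.
Hypothesis lmax : forall j, j \notin Q -> j != i -> (n j <= n l)%N.

Lemma second_lt : (n l < n i)%N.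
Proof.
rewrite ltn_neqAle imax // andbT; apply/eqP => nl.
apply: (@radical_pow l (n l).-1) => //; first by rewrite xpair_eqE (negbTE li).
exact: socle_radical.
Qed.

Lemma second_socle0 j k : (j != i) || (0 < k)%N -> D (socle l) (pow k (e j)) = 0.
Proof.
rewrite D_pow_gram; case: k => [|k] jk; last first.
  by rewrite gram_gel ?mulr0 // addnS -addSn prednK ?leq_addr.
move: jk; rewrite orbF addn0 => ji; rewrite gram_top0 ?mulr0 // => jQ.
exact: lmax.
Qed.

Lemma second_socle_neq0 : D (socle l) (e i) != 0.
Proof.
apply/eqP => z; apply: (@radical_pow l (n l).-1) => //.
  by rewrite xpair_eqE (negbTE li).
move=> j k; have [->|ji] := eqVneq j i; last by apply: second_socle0; rewrite ji.
by case: k => // k; apply: second_socle0; rewrite orbT.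
Qed.

(** Were the second largest block smaller still, X^(n i - 2) e_i would pair only
    with e_i, nontrivially because it is not in the radical; subtracting a
    multiple of it from the socle of [l], which also pairs only with e_i, would
    give a new radical vector. *)
Lemma second_size : n i = (n l).+1.
Proof.
apply/eqP; rewrite eqn_leq second_lt andbT leqNgt; apply/negP => nl2.
have niE : n i = (n i).-2.+2.
  by rewrite !prednK // -ltnS prednK //; apply: leq_ltn_trans nl2.
have nl3 : (n l <= (n i).-2)%N by rewrite niE in nl2.
pose s := pow (n i).-2 (e i).
have s0 j k : (j != i) || (0 < k)%N -> D s (pow k (e j)) = 0.
  rewrite D_pow_gram; case: k => [|k] jk; last first.
    by rewrite largest_gram0 ?mulr0 // addnS niE /= ltnS leq_addr.
  move: jk; rewrite orbF addn0 => ji; have [jQ|jQ] := boolP (j \in Q).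
    by rewrite (split_off_orth _ hs iQ jQ) mulr0.
  by rewrite gram_ge ?mulr0 //; apply: leq_trans nl3; apply: lmax.
have ltn2 : ((n i).-2 < n i)%N by rewrite [X in (_ < X)%N]niE.
have top : D s (e i) != 0.
  apply/eqP => z; apply: (@radical_pow i (n i).-2) => //.
    by rewrite xpair_eqE eqxx {2}niE /= neq_ltn ltnSn.
  move=> j k; have [->|ji] := eqVneq j i; last by apply: s0; rewrite ji.
  by case: k => // k; apply: s0; rewrite orbT.
pose c := - D (socle l) (e i) / D s (e i).
apply: (@radical_comb l (n l).-1 c i (n i).-2 0 i (n i).-1) => //;
  rewrite ?xpair_eqE ?(negbTE li) //.
move=> j k; rewrite scale0r add0r DDl DZl -/s; have [->|ji] := eqVneq j i; last first.
  by rewrite s0 ?second_socle0 ?ji // mulr0 addr0.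
case: k => [|k]; last by rewrite s0 ?second_socle0 ?orbT // mulr0 addr0.
by rewrite /= /c divfK // addNr.
Qed.

Local Notation m := (n l).-1.
Local Notation s := (pow m (e i)).

Lemma shifted_largest_ge j k : (0 < k)%N -> D s (pow k (e j)) = 0.
Proof.
move=> k0; rewrite D_pow_gram largest_gram0 ?mulr0 // second_size /=.
by rewrite -[X in (X <= _)%N]prednK // -addn1 leq_add2l.
Qed.

Lemma shifted_largest_small j : j \notin Q -> (n j < n l)%N -> D s (e j) = 0.
Proof.
move=> jQ nj; rewrite D_powr0 D_pow_gram addn0 gram_ge ?mulr0 //.
by rewrite -ltnS prednK.
Qed.

Lemma gram_largest_second : gram e i l m != 0.
Proof.
rewrite gram_sym mulf_neq0 ?oppr_eq0 ?signr_eq0 //.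
by have := second_socle_neq0; rewrite D_powr0 D_pow_gram addn0 mulf_eq0 signr_eq0.
Qed.

(** The socle of a third block pairs with the generators e_i and e_l only, and
    multiples of X^(n l - 1) e_i and of the socle of [l] can be added to it so
    that both of these pairings vanish. *)
Lemma no_third q : q \notin Q -> q != i -> q != l ->
  (forall j, j \notin Q -> j != i -> j != l -> (n j <= n q)%N) -> False.
Proof.
move=> qQ qi ql qmax; have nql : (n q <= n l)%N by apply: lmax.
have sl : D s (e l) != 0.
  rewrite D_powr0 D_pow_gram addn0 mulf_eq0 signr_eq0.
  exact: gram_largest_second.
have t_ge j k : (0 < k)%N -> D (socle q) (pow k (e j)) = 0.
  move=> k0; rewrite D_pow_gram gram_gel ?mulr0 //.
  by rewrite -[X in (X <= _)%N]prednK // -addn1 leq_add2l.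
have t0 j : j != i -> (j != l) || (n q == n l) -> D (socle q) (e j) = 0.
  move=> ji jl; rewrite D_powr0 D_pow_gram addn0 gram_top0 ?mulr0 // => jQ.
  have [jE|jl'] := eqVneq j l; last exact: qmax.
  by move: jl; rewrite jE eqxx => /eqP->.
pose x := - D (socle q) (e l) / D s (e l).
pose y := - (x * D s (e i) + D (socle q) (e i)) / D (socle l) (e i).
apply: (@radical_comb q (n q).-1 x i m y l m) => //;
  rewrite ?xpair_eqE ?(negbTE qi) ?(negbTE ql) //.
  by rewrite second_size ltnS leq_pred.
move=> j [|k]; last first.
  rewrite !DDl !DZl shifted_largest_ge // second_socle0 ?orbT // t_ge //.
  by rewrite !mulr0 !addr0.
rewrite !DDl !DZl /=; have [->|ji] := eqVneq j i.
  by rewrite /y divfK ?second_socle_neq0 //; ring.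
rewrite (@second_socle0 j 0) ?ji // mulr0 add0r; have [->|jl] := eqVneq j l.
  by rewrite /x divfK // addNr.
rewrite (t0 j) ?jl // addr0; have [jQ|jQ] := boolP (j \in Q).
  by rewrite D_powr0 (D_split _ _ iQ jQ) mulr0.
have [nj|nj] := eqVneq (n j) (n l); last first.
  by rewrite shifted_largest_small ?mulr0 // ltn_neqAle nj lmax.
(* X^(n l - 1) e_i may pair with e_j, but its coefficient x is then zero. *)
have nq : n q = n l.
  by apply/eqP; rewrite eqn_leq nql -nj qmax.
by rewrite /x t0 ?nq ?eqxx ?orbT // oppr0 !mul0r.
Qed.

(** Modulo the radical the blocks [i] and [l] have the same size and pair
    perfectly.  The top value of f_ll vanishes because [l] cannot be split off,
    so that [normalize_pair] applies. *)
Lemma residual_pair : (forall j, j \notin Q -> j != i -> j = l) ->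
  exists e', split_off e' setT.
Proof.
move=> onlyil; have il : i != l by rewrite eq_sym.
have nlm : n l = m.+1 by rewrite prednK.
have low_il k : (m < k)%N -> gram e i l k = 0.
  by move=> mk; apply: gram_ge; rewrite // nlm.
have low_ii k : (m < k)%N -> gram e i i k = 0.
  by move=> mk; apply: largest_gram0; rewrite second_size /= nlm.
have low_ll k : (m <= k)%N -> gram e l l k = 0 by apply: gram_top0.
have nl_ni : (n l <= n i)%N := ltnW second_lt.
have ni_nl : (n i <= (n l).+1)%N by rewrite second_size.
have [e' [hs' _ gil gii gll]] := normalize_pair hs iQ lQ il
  gram_largest_second low_il low_ii low_ll (fun _ => nl_ni) (leqW nl_ni) ni_nl.
have gli k : gram e' l i k = - (-1) ^+ m * (k == m)%:R.
  by rewrite gram_sym gil; case: eqP => [->//|_]; rewrite !mulr0.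
have gil' k : gram e' i l k = 1 * (k == m)%:R by rewrite mul1r.
have c2 : (- (-1) ^+ m) ^+ 2 = 1 :> R by rewrite sqrrN sqrr_sign.
exists e'; have -> : setT = i |: (l |: Q).
  apply/setP=> j; rewrite !inE; have [//|jQ] := boolP (j \in Q).
    by rewrite !orbT.
  by have [//|/(onlyil _ jQ)->] := eqVneq j i; rewrite eqxx.
apply: absorb => //.
- apply: (monomial_at_only (expr1n _ 2) gil') => j k jl.
  have [->|ji] := eqVneq j i; first exact: gii.
  have [jQ|/onlyil jE] := boolP (j \in Q); first exact: split_off_orth hs' iQ jQ.
  by rewrite jE ?eqxx // in jl.
- apply: (monomial_at_only c2 gli) => j k ji.
  have [->|jl] := eqVneq j l; first exact: gll.
  have [jQ|/onlyil jE] := boolP (j \in Q); first exact: split_off_orth hs' lQ jQ.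
  by rewrite jE ?eqxx // in jl.
- move=> j k; rewrite !inE !negb_or => /and3P[ji jl jQ].
  by rewrite (onlyil j jQ ji) eqxx in jl.
Qed.

End Residual.

Lemma residual e Q : split_off e Q ->
  (forall a b, a \notin Q -> b \notin Q -> n a = n b ->
     gram e a b (n a).-1 = 0) ->
  exists e', split_off e' setT.
Proof.
move=> hs unsplit.
have [i0 i0Q|QT] := pickP [pred i | i \notin Q]; last first.
  exists e; rewrite (_ : setT = Q) //; apply/setP => i.
  by rewrite inE -[RHS]negbK; have /= -> := QT i.
have [i iQ imax] := argmax_block i0Q.
have [l0 l0P|Zi] := pickP [pred l | (l \notin Q) && (l != i)]; last first.
  apply: (residual_single hs unsplit iQ imax) => j jQ.
  by have := Zi j; rewrite /= jQ => /negbFE/eqP.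
have [l /andP[lQ li] lmax] := argmax_block l0P.
have {}lmax j : j \notin Q -> j != i -> (n j <= n l)%N.
  by move=> jQ ji; apply: lmax; rewrite /= jQ.
apply: (residual_pair hs unsplit iQ imax lQ li lmax) => j jQ ji.
apply/eqP/contraT => jl.
have jP : [pred q | [&& q \notin Q, q != i & q != l]] j by rewrite /= jQ ji.
have [q /and3P[qQ qi ql] qmax] := argmax_block jP.
have [] := no_third hs unsplit iQ imax lQ li lmax qQ qi ql.
by move=> j' jQ' ji' jl'; apply: qmax; rewrite /= jQ' ji'.
Qed.

(** Each splitting enlarges [Q]; when none is possible, [residual] applies. *)
Theorem normal_form e : adapted e ->
  exists2 e', adapted e' & forall i, monomial_at e' i.
Proof.
move=> he; suff H d e1 Q : (#|~: Q| <= d)%N -> split_off e1 Q ->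
    exists e', split_off e' setT.
  have hs : split_off e set0 by split=> // i; rewrite inE.
  have [e' [he' _ mono]] := H _ e set0 (leqnn _) hs.
  by exists e' => // i; apply: mono; rewrite inE.
elim: d e1 Q => [|d IH] e1 Q.
  rewrite leqn0 cards_eq0 => /eqP QT hs; exists e1.
  by rewrite -(setCK Q) QT setC0 in hs.
move=> cQ hs.
have [/existsP[a /existsP[b /and4P[aQ bQ /eqP nab top]]]|none] :=
  boolP [exists a, exists b, [&& a \notin Q, b \notin Q, n a == n b
                              & gram e1 a b (n a).-1 != 0]].
  have [e2 [Q' [hs' QQ']]] := split_step hs aQ bQ (n_gt0 a) nab top.
  apply: (IH e2 Q') => //; rewrite -ltnS; apply: leq_trans cQ.
  by apply: proper_card; rewrite properC.
apply: (residual hs) => a b aQ bQ nab; apply: contraNeq none => top.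
by apply/existsP; exists a; apply/existsP; exists b; rewrite aQ bQ top nab eqxx.
Qed.

End SkewForm.

(** * Toeplitz blocks as intertwiners of shifts *)

Section ToeplitzBlocks.
Variable R : realType.

Definition shift_block k : 'M[R]_k := \matrix_(i, j) (j == i.+1 :> nat)%:R.

Lemma shift_block_mulE m n (C : 'M[R]_(m, n)) (a a' : 'I_m) b :
  a' = a.+1 :> nat -> (shift_block m *m C) a b = C a' b.
Proof.
move=> aa'; rewrite mxE (bigD1 a') //= mxE aa' eqxx mul1r big1 ?addr0 // => i ia.
rewrite mxE -aa' (_ : (i == a' :> nat) = false) ?mul0r //.
by apply: contraNF ia => /eqP h; apply/eqP/val_inj.
Qed.

Lemma shift_block_mul_last m n (C : 'M[R]_(m, n)) (a : 'I_m) b :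
  a.+1 = m -> (shift_block m *m C) a b = 0.
Proof.
move=> am; rewrite mxE big1 // => i _; rewrite mxE am.
by rewrite (_ : (i == m :> nat) = false) ?mul0r // ltn_eqF.
Qed.

Lemma mul_shift_blockE m n (C : 'M[R]_(m, n)) a (b b' : 'I_n) :
  b = b'.+1 :> nat -> (C *m shift_block n) a b = C a b'.
Proof.
move=> bb'; rewrite mxE (bigD1 b') //= mxE bb' eqxx mulr1 big1 ?addr0 // => i ib.
rewrite mxE bb' (_ : (b'.+1 == i.+1 :> nat) = false) ?mulr0 //.
by apply: contraNF ib => /eqP[h]; apply/eqP/val_inj.
Qed.

Lemma mul_shift_block_first m n (C : 'M[R]_(m, n)) a (b : 'I_n) :
  b = 0%N :> nat -> (C *m shift_block n) a b = 0.
Proof. by move=> b0; rewrite mxE big1 // => i _; rewrite mxE b0 mulr0. Qed.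

(** The truncated subtraction [n - m] is the number of leading zero columns, so
    this covers both shapes of an upper Toeplitz block. *)
Definition toeplitz_symbol m n (C : 'M[R]_(m, n)) (f : nat -> R) : Prop :=
  forall a b, C a b = if (a + (n - m) <= b)%N then f (b - (a + (n - m)))%N else 0.

Lemma upper_toeplitz_sq_symbol k (T : 'M[R]_k) :
  upper_toeplitz_sq T -> exists f, toeplitz_symbol T f.
Proof.
case=> /is_trig_mxP tri diag.
case: k T tri diag => [|k] T tri diag; first by exists (fun=> 0) => -[].
exists (fun d => T ord0 (inord d)) => a b; rewrite subnn addn0.
case: leqP => [ab|ba]; last by have := tri b a ba; rewrite mxE.
by apply: diag => /=; rewrite inordK; have := ltn_ord b; lia.
Qed.

Lemma upper_toeplitz_block_symbol m n (C : 'M[R]_(m, n)) :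
  upper_toeplitz_block C -> exists f, toeplitz_symbol C f.
Proof.
case=> [[e [T [/upper_toeplitz_sq_symbol[f hf] ->]]]|
        [e [T [/upper_toeplitz_sq_symbol[f hf] ->]]]]; exists f => a b.
- rewrite castmxE mxE; case: splitP => b' /= bE.
    rewrite mxE bE ifN //; have := ltn_ord b'; lia.
  rewrite cast_ord_id hf bE subnn addn0 addnC leq_add2l; case: ifP => // _.
  by congr f; lia.
- rewrite castmxE mxE; case: splitP => a' /= aE.
    by rewrite hf /= aE subnn (_ : n - m = 0)%N //; lia.
  rewrite mxE aE ifN //; have := ltn_ord b; lia.
Qed.

Lemma symbol_upper_toeplitz_block m n (C : 'M[R]_(m, n)) f :
  toeplitz_symbol C f -> upper_toeplitz_block C.
Proof.
move=> hC.
pose T k : 'M[R]_k := \matrix_(a, b) if (a <= b)%N then f (b - a)%N else 0.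
have hT k : upper_toeplitz_sq (T k).
  split; first by apply/is_trig_mxP => a b ab; rewrite !mxE leqNgt ab.
  move=> a b a' b' h; rewrite !mxE.
  have -> : (b - a = b' - a')%N by lia.
  by have -> : (a <= b)%N = (a' <= b')%N by lia.
have [mn|nm] := leqP m n; [left | right].
- exists (subnK mn), (T m); split=> //; apply/matrixP => a b.
  rewrite castmxE mxE hC; case: splitP => b' /= bE.
    rewrite mxE bE ifN //; have := ltn_ord b'; lia.
  rewrite mxE /= bE [(a + _)%N]addnC leq_add2l; case: ifP => // _.
  by congr f; lia.
- exists (subnKC (ltnW nm)), (T n); split=> //; apply/matrixP => a b.
  have nm0 : (n - m = 0)%N by lia.
  rewrite castmxE mxE hC nm0 addn0; case: splitP => a' /= aE.
    by rewrite mxE /= aE.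
  by rewrite mxE aE ifN //; have := ltn_ord b; lia.
Qed.

Lemma symbol_commute m n (C : 'M[R]_(m, n)) f :
  toeplitz_symbol C f -> shift_block m *m C = C *m shift_block n.
Proof.
move=> hC; apply/matrixP => a b; have am := ltn_ord a; have bn := ltn_ord b.
have [b0|b0] := posnP b.
  rewrite mul_shift_block_first //.
  have [am1|am1] := leqP m a.+1; first by rewrite shift_block_mul_last //; lia.
  rewrite (@shift_block_mulE _ _ _ a (Ordinal am1)) // hC ifN //= b0; lia.
have b1 : (b.-1 < n)%N by lia.
rewrite (@mul_shift_blockE _ _ _ _ b (Ordinal b1)) ?hC /=; last by lia.
have [am1|am1] := leqP m a.+1.
  by rewrite shift_block_mul_last ?ifN //; lia.
rewrite (@shift_block_mulE _ _ _ a (Ordinal am1)) // hC /=.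
have -> : (a.+1 + (n - m) <= b)%N = (a + (n - m) <= b.-1)%N by lia.
by have -> : (b - (a.+1 + (n - m)) = b.-1 - (a + (n - m)))%N by lia.
Qed.

(** Commutation says that the entries are constant along diagonals, that the
    first column vanishes below its first entry and that the last row vanishes
    before its last entry.  So a diagonal that starts in the first column
    below the first row, or ends in the last row before the last column, is
    zero, and the other diagonals are determined by the first row. *)
Lemma commute_symbol m n (C : 'M[R]_(m, n)) :
  shift_block m *m C = C *m shift_block n -> exists f, toeplitz_symbol C f.
Proof.
move=> comm.
have step (a a' : 'I_m) (b b' : 'I_n) : a' = a.+1 :> nat -> b' = b.+1 :> nat ->
    C a' b' = C a b.
  move=> aa' bb'; rewrite -(mul_shift_blockE _ _ bb') -comm.
  by rewrite (shift_block_mulE _ _ aa').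
have first_col (a a' : 'I_m) (b : 'I_n) : a' = a.+1 :> nat -> b = 0%N :> nat ->
    C a' b = 0.
  move=> aa' b0; rewrite -(shift_block_mulE _ _ aa') comm.
  exact: mul_shift_block_first.
have last_row (a : 'I_m) (b b' : 'I_n) : a.+1 = m -> b' = b.+1 :> nat ->
    C a b = 0.
  move=> am bb'; rewrite -(mul_shift_blockE _ _ bb') -comm.
  exact: shift_block_mul_last.
have low d (a : 'I_m) (b : 'I_n) : (a + d = m.-1)%N -> (b + m < n + a)%N ->
    C a b = 0.
  elim: d a b => [|d IH] a b had hb; have am := ltn_ord a.
    have b1 : (b.+1 < n)%N by lia.
    by apply: (@last_row _ _ (Ordinal b1)) => //; lia.
  have a1 : (a.+1 < m)%N by lia.
  have b1 : (b.+1 < n)%N by lia.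
  by rewrite -(step a (Ordinal a1) b (Ordinal b1)) // IH //=; lia.
case: m C comm step first_col last_row low => [|m] C comm step first_col _ low.
  by exists (fun=> 0) => -[].
case: n C comm step first_col low => [|n] C comm step first_col low.
  by exists (fun=> 0) => a [].
have red k (a : 'I_m.+1) (b : 'I_n.+1) : a = k :> nat ->
    C a b = if (a <= b)%N then C ord0 (inord (b - a)) else 0.
  elim: k a b => [|k IH] a b ak; have am := ltn_ord a; have bn := ltn_ord b.
    by rewrite ak leq0n subn0 inord_val (_ : a = ord0) //; apply: val_inj.
  have am1 : (a.-1 < m.+1)%N by lia.
  have [b0|b0] := posnP b.
    rewrite (@first_col (Ordinal am1)) //=; last by lia.
    by rewrite b0 leqn0 ak.
  have bn1 : (b.-1 < n.+1)%N by lia.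
  rewrite (@step (Ordinal am1) a (Ordinal bn1)) /=; [|lia..].
  rewrite IH /=; last by lia.
  have -> : (a.-1 <= b.-1)%N = (a <= b)%N by lia.
  by have -> : (b.-1 - a.-1 = b - a)%N by lia.
exists (fun d => C ord0 (inord (d + (n - m)))) => a b; rewrite (red _ a b erefl).
rewrite subSS; have [h|h] := leqP (a + (n - m)) b.
  rewrite ifT; last by lia.
  by congr (C _ (inord _)); lia.
case: ifP => // ab; apply: (low m) => //=; rewrite inordK; have := ltn_ord b; lia.
Qed.

Lemma upper_toeplitz_blockP m n (C : 'M[R]_(m, n)) :
  upper_toeplitz_block C <-> shift_block m *m C = C *m shift_block n.
Proof.
split=> [/upper_toeplitz_block_symbol[f]|/commute_symbol[f]].
  exact: symbol_commute.
exact: symbol_upper_toeplitz_block.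
Qed.

End ToeplitzBlocks.

(** * Block matrices and the skew form *)

Section BlockMatrices.
Variables (R : realType) (p : nat) (n : 'I_p -> nat).
Local Notation N := (\sum_i n i)%N.

Lemma mul_mxdiag (A B : forall i, 'M[R]_(n i)) :
  (\mxdiag_i A i) *m (\mxdiag_i B i) = \mxdiag_i (A i *m B i).
Proof.
rewrite {2 3}/mxdiag mul_mxdiag_mxblock; apply: eq_mxblock => i j.
by case: eqVneq => [<-|_]; rewrite ?conform_mx_id ?mulmx0.
Qed.

Lemma mxdiag_mul_eqP (A B : forall i, 'M[R]_(n i)) (C : 'M[R]_N) :
  (\mxdiag_i A i) *m C = C *m (\mxdiag_i B i) <->
  forall i j, A i *m submxblock C i j = submxblock C i j *m B j.
Proof.
rewrite -{1 2}(submxblockK C) mul_mxdiag_mxblock mul_mxblock_mxdiag.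
exact: iff_sym (eq_mxblockP _ _).
Qed.

Definition shift_mx : 'M[R]_N := \mxdiag_i shift_block R (n i).

Definition eigen_mx (lam : 'I_p -> R) : 'M[R]_N := \mxdiag_i (lam i)%:M.

Lemma upper_toeplitzP (C : 'M[R]_N) :
  upper_toeplitz C <-> shift_mx *m C = C *m shift_mx.
Proof.
rewrite mxdiag_mul_eqP.
by split=> h i j; apply/upper_toeplitz_blockP; apply: h.
Qed.

(** Used with [mu = lam] for S, and with [mu = - lam] for C. *)
Lemma eigen_mx_commP (lam mu : 'I_p -> R) (C : 'M[R]_N) :
  eigen_mx lam *m C = C *m eigen_mx mu <->
  forall i j, lam i <> mu j -> submxblock C i j = 0.
Proof.
rewrite mxdiag_mul_eqP; split=> h i j.
  move=> /eqP lm; have := h i j; rewrite mul_scalar_mx mul_mx_scalar => /eqP.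
  rewrite -subr_eq0 -scalerBl scaler_eq0 subr_eq0 (negbTE lm) /= => /eqP.
  exact.
rewrite mul_scalar_mx mul_mx_scalar.
have [->//|/eqP lm] := eqVneq (lam i) (mu j).
by rewrite (h i j lm) !scaler0.
Qed.

Lemma shift_block_alt k :
  alt_block R k *m shift_block R k = - (shift_block R k *m alt_block R k).
Proof.
rewrite mul_diag_mx mul_mx_diag; apply/matrixP => i j; rewrite !mxE.
by case: eqP => [->|_]; rewrite /= ?exprS ?mulr1n ?mulr0n; ring.
Qed.

Lemma shift_mx_alt : alt_mx R n *m shift_mx = - (shift_mx *m alt_mx R n).
Proof.
rewrite !mul_mxdiag -mxdiagN; apply/eq_mxdiagP => i; exact: shift_block_alt.
Qed.

Lemma shift_mx_antidiag : antidiag_mx n *m shift_mx = shift_mx^T *m antidiag_mx n.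
Proof.
rewrite tr_mxdiag !mul_mxdiag; apply/eq_mxdiagP => i.
apply/matrixP => a b; rewrite !mxE (bigD1 (rev_ord a)) //= big1 => [|c ca].
  rewrite addr0 (bigD1 (rev_ord b)) //= big1 => [|c cb].
    rewrite addr0 !mxE rev_ordK !eqxx mul1r mulr1.
    by congr (nat_of_bool _)%:R; have := ltn_ord a; have := ltn_ord b => /=; lia.
  rewrite !mxE (_ : (b == rev_ord c) = false) ?mulr0 //.
  by apply: contraNF cb => /eqP->; rewrite rev_ordK.
by rewrite !mxE (negbTE ca) mul0r.
Qed.

Lemma antidiag_mx_invol : antidiag_mx n *m antidiag_mx n = 1%:M :> 'M[R]_N.
Proof.
rewrite mul_mxdiag -mxdiagZ; apply/eq_mxdiagP => i.
apply/matrixP => a b; rewrite !mxE (bigD1 (rev_ord a)) //= big1 => [|c ca].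
  by rewrite !mxE rev_ordK eqxx mul1r addr0 eq_sym.
by rewrite !mxE (negbTE ca) mul0r.
Qed.

Lemma tr_antidiag_mx : (antidiag_mx n)^T = antidiag_mx n :> 'M[R]_N.
Proof.
rewrite tr_mxdiag; apply/eq_mxdiagP => i; apply/matrixP => a b; rewrite !mxE.
by congr (nat_of_bool _)%:R; apply/eqP/eqP => ->; rewrite rev_ordK.
Qed.

Lemma tr_eigen_mx lam : (eigen_mx lam)^T = eigen_mx lam.
Proof. by rewrite tr_mxdiag; apply/eq_mxdiagP => i; rewrite tr_scalar_mx. Qed.

Lemma eigen_mx_antidiag lam :
  antidiag_mx n *m eigen_mx lam = eigen_mx lam *m antidiag_mx n.
Proof.
by rewrite !mul_mxdiag; apply/eq_mxdiagP => i; rewrite mul_scalar_mx mul_mx_scalar.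
Qed.

Lemma eigen_mxN lam : eigen_mx (fun i => - lam i) = - eigen_mx lam.
Proof. by rewrite -mxdiagN; apply/eq_mxdiagP => i; rewrite raddfN. Qed.

Definition form_mx (C : 'M[R]_N) : 'M[R]_N := antidiag_mx n *m C.

Lemma form_mx_rank C : \rank (form_mx C) = \rank C.
Proof.
have full : row_full (antidiag_mx n : 'M[R]_N).
  by rewrite row_full_unit; have [] := mulmx1_unit antidiag_mx_invol.
by rewrite /form_mx (eqmxMfull _ full).
Qed.

Lemma form_mx_skew C : block_skew C -> (form_mx C)^T = - form_mx C.
Proof.
rewrite /block_skew /block_star => h; rewrite trmx_mul tr_antidiag_mx.
by rewrite /form_mx -mulmxN -h !mulmxA antidiag_mx_invol mul1mx.
Qed.

(** Conjugation by the antidiagonal matrix transposes the shift, and the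
    alternating signs turn commutation into anticommutation. *)
Lemma form_mx_shift C : upper_alt_toeplitz C ->
  shift_mx^T *m form_mx C = - (form_mx C *m shift_mx).
Proof.
case=> C' /upper_toeplitzP hC' ->; rewrite /form_mx.
rewrite mulmxA -shift_mx_antidiag -!mulmxA -mulmxN; congr (_ *m _).
by rewrite -hC' !mulmxA shift_mx_alt mulNmx opprK.
Qed.

Lemma form_mx_eigen lam C :
  (forall i j, lam i <> - lam j -> submxblock C i j = 0) ->
  eigen_mx lam *m form_mx C = - (form_mx C *m eigen_mx lam).
Proof.
move=> /(eigen_mx_commP lam (fun j => - lam j)); rewrite eigen_mxN => h.
by rewrite mulmxA -eigen_mx_antidiag -mulmxA h mulmxN -mulmxA mulmxN.
Qed.

End BlockMatrices.

(** * Signed matchings *)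

Section SignedMatchings.
Variable R : realType.

(** J_N and J_(N, N - 1) in one formula; in both cases h = N/2 rounded down. *)
Definition matching_mx N h : 'M[R]_N := \matrix_(s, t)
  (((s < h) && (t == s + h :> nat))%N%:R - ((t < h) && (s == t + h :> nat))%N%:R).

Lemma conform_mxE (T : Type) m n m' n' (B : 'M[T]_(m, n)) (A : 'M[T]_(m', n'))
    (em : m' = m) (en : n' = n) i j :
  conform_mx B A i j = A (cast_ord (esym em) i) (cast_ord (esym en) j).
Proof.
by case: m / em B i; case: n / en j => j B i; rewrite conform_mx_id !cast_ord_id.
Qed.

Lemma sympl_mx_matching r : ~~ odd r -> sympl_mx r = matching_mx r r./2.
Proof.
move=> ev; have e : (r./2 + r./2 = r)%N by lia.
apply/matrixP => s t; rewrite /sympl_mx (conform_mxE _ _ e e) !mxE.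
case: splitP => s' /= sE; rewrite mxE; case: splitP => t' /= tE;
  rewrite !mxE -?val_eqE /= sE tE; have := ltn_ord s'; have := ltn_ord t';
  move=> ht hs.
- rewrite (_ : (t' == s' + r./2 :> nat) = false)%N ?andbF; last by lia.
  by rewrite (_ : (s' == t' + r./2 :> nat) = false)%N ?andbF ?subrr //; lia.
- rewrite hs (_ : (r./2 + t' < r./2)%N = false) /= ?subr0; last by lia.
  by congr (nat_of_bool _)%:R; lia.
- rewrite ht (_ : (r./2 + s' < r./2)%N = false) /= ?sub0r; last by lia.
  by congr (- (nat_of_bool _)%:R); lia.
- rewrite (_ : (r./2 + s' < r./2)%N = false); last by lia.
  by rewrite (_ : (r./2 + t' < r./2)%N = false) ?subrr //; lia.
Qed.

Lemma sympl_pad_mx_matching N r : ~~ odd r -> (r <= N)%N ->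
  sympl_pad_mx N r = matching_mx N r./2.
Proof.
move=> ev rN; have e : (r + (N - r) = N)%N by lia.
apply/matrixP => s t; rewrite /sympl_pad_mx (conform_mxE _ _ e e) !mxE.
case: splitP => s' /= sE; rewrite mxE; case: splitP => t' /= tE;
  rewrite ?sympl_mx_matching // !mxE /= sE tE //;
  have := ltn_ord s'; have := ltn_ord t' => ht hs;
  do 2!(case: andP => [[h1 /eqP h2]|_]; first by exfalso; lia);
  by rewrite subrr.
Qed.

(** Let [g] exchange the two indices of each nonzero entry.  Listing first the
    rows [r] with entry 1, then their partners [g r], which by skew-symmetry are
    the rows with entry -1, and finally the zero rows gives the permutation. *)
Lemma skew_signed_matching N (M : 'M[R]_N) : M^T = - M ->
  (forall r c c', M r c != 0 -> M r c' != 0 -> c = c') ->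
  (forall r c, M r c != 0 -> M r c ^+ 2 = 1) ->
  exists h (s : 'S_N), (h + h <= N)%N /\
    M = (perm_mx s)^T *m matching_mx N h *m perm_mx s.
Proof.
move=> skew single unitary.
pose g r := odflt r [pick c | M r c != 0].
have gP r c : M r c != 0 -> g r = c.
  move=> nz; rewrite /g; case: pickP => [c' nz'|/(_ c)]; last by rewrite nz.
  exact: single nz' nz.
have ME r c : M r c = (c == g r)%:R * M r (g r).
  have [->|cg] := eqVneq c (g r); first by rewrite mul1r.
  by rewrite mul0r; apply: contraNeq cg => /gP->.
have skewE r c : M c r = - M r c by have /matrixP/(_ r c) := skew; rewrite !mxE.
have gK r : M r (g r) != 0 -> g (g r) = r.
  by move=> nz; apply: gP; rewrite skewE oppr_eq0.
have nz1 : (1 : R) != 0 := oner_neq0 R.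
have nzm1 : (- 1 : R) != 0 by rewrite oppr_eq0.
have m1 : (- 1 : R) == 1 = false by apply/negP => /eqP; lra.
pose A := [seq r <- enum 'I_N | M r (g r) == 1].
pose Z := [seq r <- enum 'I_N | M r (g r) == 0].
have AP r : (r \in A) = (M r (g r) == 1) by rewrite mem_filter mem_enum andbT.
have ZP r : (r \in Z) = (M r (g r) == 0) by rewrite mem_filter mem_enum andbT.
have AgK r : r \in A -> g (g r) = r by rewrite AP => /eqP h; rewrite gK ?h.
have gAP r : r \in map g A -> M r (g r) = - 1.
  move=> /mapP[x xA ->]; rewrite AgK // skewE.
  by move: xA; rewrite AP => /eqP->.
pose l := A ++ map g A ++ Z.
have A_uniq : uniq A by apply: filter_uniq; apply: enum_uniq.
have Z_uniq : uniq Z by apply: filter_uniq; apply: enum_uniq.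
have l_uniq : uniq l.
  rewrite !cat_uniq A_uniq Z_uniq andbT andTb.
  apply/and3P; split.
  - rewrite has_cat negb_or; apply/andP; split; apply/hasPn => x.
      by move=> /gAP h; rewrite AP h m1.
    by rewrite ZP AP => /eqP->; rewrite eq_sym.
  - rewrite map_inj_in_uniq // => x y xA yA gxy.
    by rewrite -(AgK x xA) gxy AgK.
  - apply/hasPn => x; rewrite ZP => /eqP h; apply/negP => /gAP.
    by rewrite h => /eqP; rewrite eq_sym (negbTE nzm1).
have l_mem x : x \in l.
  rewrite !mem_cat AP ZP; have [//|nz1'] := eqVneq (M x (g x)) 1.
  have [//|nz] := eqVneq (M x (g x)) 0; first by rewrite orbT.
  rewrite orbF; apply/mapP; exists (g x); last by rewrite gK.
  rewrite AP gK // skewE; have /eqP := unitary _ _ nz.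
  by rewrite sqrf_eq1 (negbTE nz1') /= => /eqP->; rewrite opprK.
have l_size : size l = N.
  rewrite -[RHS](size_enum_ord N); apply: perm_size; apply: uniq_perm => //.
    exact: enum_uniq.
  by move=> x; rewrite l_mem mem_enum.
pose h := size A.
have hN : (h + h + size Z = N)%N by rewrite -[RHS]l_size !size_cat size_map addnA.
have inj : injective (fun s : 'I_N => nth s l s).
  move=> s t; rewrite (set_nth_default t) ?l_size // => /eqP.
  by rewrite nth_uniq ?l_size // => /eqP/val_inj.
pose sg := perm inj; have sgE s : sg s = nth s l s by rewrite permE.
have sgA (s : 'I_N) : (s < h)%N -> sg s \in A.
  by move=> sh; rewrite sgE nth_cat -/h sh mem_nth.
have sgB (s t : 'I_N) : (s < h)%N -> t = (s + h)%N :> nat -> sg t = g (sg s).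
  move=> sh tE; rewrite !sgE !nth_cat -/h sh tE ltnNge leq_addl /= addnK size_map.
  by rewrite sh (nth_map s).
have sgZ (s : 'I_N) : (h + h <= s)%N -> sg s \in Z.
  move=> sh; rewrite sgE !nth_cat size_map -/h ltnNge (leq_trans _ sh) ?leq_addl //=.
  rewrite ltnNge ifN; last by rewrite negbK; lia.
  by apply: mem_nth; rewrite -subnDA ltn_subLR // hN.
have MA (s t c : 'I_N) : (s < h)%N -> t = (s + h)%N :> nat ->
    M (sg s) (sg c) = (c == t)%:R.
  move=> sh tE; rewrite ME -(sgB s t) // (inj_eq perm_inj).
  by have := sgA s sh; rewrite AP (sgB s t) // => /eqP->; rewrite mulr1.
have key (s t : 'I_N) : M (sg s) (sg t) = matching_mx N h s t.
  rewrite mxE; have [sh|hs] := ltnP s h.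
    have shN : (s + h < N)%N by lia.
    rewrite (MA s (Ordinal shN)) // andTb -val_eqE /=.
    by rewrite (_ : (s == t + h :> nat)%N = false) ?andbF ?subr0 //; lia.
  rewrite andFb sub0r; have [sh|hhs] := ltnP s (h + h).
    have shN : (s - h < N)%N by have := ltn_ord s; lia.
    have hh : (s - h < h)%N by lia.
    have gs : sg s = g (sg (Ordinal shN)) by apply: sgB => //=; lia.
    rewrite skewE; congr (- _); have [th|ht] := ltnP t h.
      have tN : (t + h < N)%N by lia.
      by rewrite (MA t (Ordinal tN)).
    apply/eqP/negPn/negP => nz; have := gP _ _ nz.
    have : M (sg s) (sg t) != 0 by rewrite skewE oppr_eq0.
    move=> /gP; rewrite gs AgK ?sgA // => /perm_inj tE.
    by move: ht; rewrite -tE /= leqNgt hh.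
  have /eqP z : M (sg s) (g (sg s)) == 0 by rewrite -ZP sgZ.
  rewrite ME z mulr0; case: andP => [[h1 /eqP h2]|_]; last by rewrite oppr0.
  by exfalso; lia.
exists h, sg; split; first by lia.
apply/matrixP => x y; rewrite -{1}(permKV sg x) -{1}(permKV sg y) key.
rewrite [in RHS]mxE (bigD1 (sg^-1 y)%g) //= big1 => [|t ty].
  rewrite addr0 [in RHS]mxE (bigD1 (sg^-1 x)%g) //= big1 => [|t tx].
    by rewrite addr0 !mxE !permKV !eqxx mul1r mulr1.
  rewrite !mxE (_ : (sg t == x) = false) ?mul0r //.
  by apply: contraNF tx => /eqP<-; rewrite permK.
rewrite !mxE (_ : (sg t == y) = false) ?mulr0 //.
by apply: contraNF ty => /eqP<-; rewrite permK.
Qed.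

Lemma matching_mx_rank N h : (h + h <= N)%N ->
  (\rank (matching_mx N h) <= h + h)%N.
Proof.
move=> hN; have -> : matching_mx N h = pid_mx (h + h) *m matching_mx N h.
  apply/matrixP => s t; rewrite !mxE (bigD1 s) //= big1 => [|i si].
    rewrite !mxE eqxx addr0; case: (ltnP s (h + h)) => [|hs]; first by rewrite mul1r.
    rewrite mul0r; do 2!(case: andP => [[h1 /eqP h2]|_]; first by exfalso; lia).
    by rewrite subrr.
  by rewrite !mxE val_eqE eq_sym (negbTE si) mul0r.
by apply: leq_trans (mxrankM_maxl _ _) _; rewrite rank_pid_mx.
Qed.

End SignedMatchings.

(** * From generators to matrices *)

Section JordanBases.
Import tagnat.
Variables (R : realType) (p : nat) (n : 'I_p -> nat) (lam : 'I_p -> R).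
Hypothesis n_gt0 : forall i, (0 < n i)%N.
Local Notation N := (\sum_i n i)%N.
Local Notation V := 'cV[R]_N.
Local Notation X := (@mulmx R N N 1 (shift_mx R n)).
Local Notation L := (@mulmx R N N 1 (eigen_mx n lam)).
Implicit Types (e : 'I_p -> V) (C G : 'M[R]_N).

Definition unit_vec i (a : 'I_(n i)) : V := delta_mx (Rank i a) 0.
Arguments unit_vec : clear implicits.

Lemma mx_eq_unit_vec (A B : 'M[R]_N) :
  (forall i a, A *m unit_vec i a = B *m unit_vec i a) -> A = B.
Proof.
move=> h; apply/matrixP => r c; have /matrixP/(_ r 0) := h (sig1 c) (sig2 c).
by rewrite /unit_vec sig2K -!colE !mxE.
Qed.

Lemma eq_RankE i j (a : 'I_(n i)) (b : 'I_(n j)) :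
  (Rank i a == Rank j b) = (i == j) && (a == b :> nat).
Proof. by rewrite -val_eqE eq_Rank. Qed.

Lemma mxdiag_entry (F : forall i, 'M[R]_(n i)) i j a b :
  (\mxdiag_i F i) (Rank i a) (Rank j b) =
  (if i == j then conform_mx 0 (F i) else 0) a b.
Proof.
have /matrixP/(_ a b) := mxblockK
  (fun i j => if i == j then conform_mx 0 (F i) else 0 : 'M[R]_(n i, n j)) i j.
by rewrite mxE => <-.
Qed.

Lemma shift_mx_entry i j a b :
  shift_mx R n (Rank i a) (Rank j b) = ((i == j) && (b == a.+1 :> nat))%:R.
Proof.
rewrite mxdiag_entry; case: eqVneq => [ij|_]; last by rewrite mxE.
by case: j / ij b => b; rewrite conform_mx_id mxE.
Qed.

Lemma shift_unit_vecS i (a a' : 'I_(n i)) : a = a'.+1 :> nat ->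
  shift_mx R n *m unit_vec i a = unit_vec i a'.
Proof.
move=> aa'; apply/colP => r; rewrite -(sig2K r) -colE mxE shift_mx_entry mxE.
by rewrite eqxx andbT eq_RankE aa' eqSS (eq_sym (a' : nat)).
Qed.

Lemma shift_unit_vec0 i (a : 'I_(n i)) : a = 0%N :> nat ->
  shift_mx R n *m unit_vec i a = 0.
Proof.
move=> a0; apply/colP => r; rewrite -(sig2K r) -colE mxE shift_mx_entry mxE a0.
by rewrite andbF.
Qed.

Lemma eigen_unit_vec i a : eigen_mx n lam *m unit_vec i a = lam i *: unit_vec i a.
Proof.
apply/colP => r; rewrite -(sig2K r) -colE mxE mxdiag_entry !mxE eqxx andbT eq_RankE.
case: eqVneq => [ij|_]; last by rewrite mxE mulr0.
case: i / ij a => a; rewrite conform_mx_id mxE val_eqE mulr_natr //.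
Qed.

Let last_lt i : ((n i).-1 < n i)%N. Proof. by rewrite ltn_predL. Qed.

(** X moves down within a block, so the last unit vector generates it. *)
Definition gen_vec i : V := unit_vec i (Ordinal (last_lt i)).

Lemma pow_gen_vec i k (a : 'I_(n i)) : (a + k.+1 = n i)%N ->
  iter k X (gen_vec i) = unit_vec i a.
Proof.
elim: k a => [|k IH] a ak.
  by congr unit_vec; apply: val_inj => /=; lia.
have a1 : (a.+1 < n i)%N by lia.
by rewrite iterS (IH (Ordinal a1)) /=; [apply: shift_unit_vecS | lia].
Qed.

Lemma gen_vec_adapted : adapted X L n lam gen_vec.
Proof.
have unit_gen i a : gen_by X setT gen_vec (unit_vec i a).
  have ak : (a + (n i - a.+1).+1 = n i)%N by have := ltn_ord a; lia.
  by rewrite -(pow_gen_vec ak); apply/gen_by_pow/gen_by_base; rewrite inE.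
split.
- move=> i; have niE : n i = (n i).-1.+1 by rewrite prednK.
  rewrite {1}niE iterS (@pow_gen_vec i _ (Ordinal (n_gt0 i))) //=.
  exact: shift_unit_vec0.
- by move=> i; apply: eigen_unit_vec.
- move=> v; rewrite (matrix_sum_delta v).
  apply: gen_by_sum => r; rewrite big_ord1; apply: gen_by_scale.
  by rewrite -(sig2K r); apply: unit_gen.
Qed.

(** The exponents are those for which the standard generators [gen_vec] give
    the identity matrix. *)
Definition basis_mx e : 'M[R]_N :=
  \matrix_(r, c) (iter (n (sig1 c) - (sig2 c).+1) X (e (sig1 c))) r 0.

Lemma basis_unit_vec e i (a : 'I_(n i)) :
  basis_mx e *m unit_vec i a = iter (n i - a.+1) X (e i).
Proof.
apply/colP => r; rewrite -colE !mxE.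
have -> : sig2 (Rank i a) = a :> nat by rewrite Rank2K.
by rewrite Rank1K.
Qed.

Lemma basis_mx_shift e : adapted X L n lam e ->
  shift_mx R n *m basis_mx e = basis_mx e *m shift_mx R n.
Proof.
case=> hX _ _; apply: mx_eq_unit_vec => i a; rewrite -!mulmxA basis_unit_vec.
have [a0|a0] := posnP a.
  rewrite shift_unit_vec0 // mulmx0 a0 subn1 -[LHS]/(iter (n i).-1.+1 X (e i)).
  by rewrite prednK.
have a1 : (a.-1 < n i)%N by have := ltn_ord a; lia.
rewrite (@shift_unit_vecS i a (Ordinal a1)) /= ?prednK // basis_unit_vec /=.
rewrite prednK // (_ : n i - a = (n i - a.+1).+1)%N //.
by have := ltn_ord a; lia.
Qed.

Lemma shift_eigen_comm :
  eigen_mx n lam *m shift_mx R n = shift_mx R n *m eigen_mx n lam.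
Proof.
by rewrite !mul_mxdiag; apply/eq_mxdiagP => i; rewrite mul_scalar_mx mul_mx_scalar.
Qed.

Lemma eigen_shiftX v : L (X v) = X (L v).
Proof. by rewrite !mulmxA shift_eigen_comm. Qed.

Lemma basis_mx_eigen e : adapted X L n lam e ->
  eigen_mx n lam *m basis_mx e = basis_mx e *m eigen_mx n lam.
Proof.
case=> _ hL _; apply: mx_eq_unit_vec => i a.
rewrite -!mulmxA eigen_unit_vec -scalemxAr basis_unit_vec.
by rewrite (L_pow eigen_shiftX) hL powZ.
Qed.

(** The range of [basis_mx e] is stable under X and contains the generators,
    hence is everything. *)
Lemma basis_mx_unit e : adapted X L n lam e -> basis_mx e \in unitmx.
Proof.
move=> he; have [_ _ hgen] := he.
have ex v : gen_by X setT e v -> exists w, v = basis_mx e *m w.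
  elim=> {v} [|i _|u v _ [wu ->] _ [wv ->]|c u _ [w ->]|u _ [w ->]].
  - by exists 0; rewrite mulmx0.
  - exists (gen_vec i); rewrite basis_unit_vec /= prednK // subnn //.
  - by exists (wu + wv); rewrite mulmxDr.
  - by exists (c *: w); rewrite scalemxAr.
  - by exists (X w); rewrite /= !mulmxA basis_mx_shift.
have [f hf] := fin_all_exists (fun r : 'I_N => ex _ (hgen (delta_mx r 0))).
have right_inv : basis_mx e *m (\matrix_(r, c) f c r 0) = 1%:M.
  apply/matrixP => r c; have /matrixP/(_ r 0) := hf c.
  rewrite !mxE eqxx andbT => ->.
  by apply: eq_bigr => j _; congr (_ * _); rewrite mxE.
by have [] := mulmx1_unit right_inv.
Qed.

Lemma basis_coordinates e i k : adapted X L n lam e -> (k < n i)%N ->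
  exists phi : V -> R,
    (forall c u v, phi (c *: u + v) = c * phi u + phi v) /\
    (forall j l, (l < n j)%N ->
       phi (iter l X (e j)) = ((j == i) && (l == k))%:R).
Proof.
move=> he ki; have hi : (n i - k.+1 < n i)%N by lia.
exists (fun v => (invmx (basis_mx e) *m v) (Rank i (Ordinal hi)) 0).
split=> [c u v|j l lj].
  by rewrite mulmxDr -scalemxAr !mxE.
have hj : (n j - l.+1 < n j)%N by lia.
have -> : iter l X (e j) = basis_mx e *m unit_vec j (Ordinal hj).
  by rewrite basis_unit_vec /=; congr (iter _ _ _); lia.
rewrite mulKmx ?basis_mx_unit // mxE eqxx andbT eq_RankE /= eq_sym.
case: eqVneq => //= ij; congr (nat_of_bool _)%:R; rewrite ij in hj lj *; lia.
Qed.

Section Form.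
Variable G : 'M[R]_N.
Hypothesis G_skew : G^T = - G.
Hypothesis G_shift : (shift_mx R n)^T *m G = - (G *m shift_mx R n).
Hypothesis G_eigen : eigen_mx n lam *m G = - (G *m eigen_mx n lam).
Hypothesis G_rank : (N.-1 <= \rank G)%N.

Definition bilin (u v : V) : R := (u^T *m G *m v) 0 0.

Lemma bilin_linl (a : R) u v w :
  bilin (a *: u + v) w = a * bilin u w + bilin v w.
Proof. by rewrite /bilin linearD linearZ /= !mulmxDl -!scalemxAl !mxE. Qed.

Lemma bilin_skew u v : bilin u v = - bilin v u.
Proof.
rewrite /bilin -[u^T *m G *m v]trmxK mxE !trmx_mul trmxK G_skew mulmxA.
by rewrite mulmxN mulNmx mxE.
Qed.

Lemma bilin_shift u v : bilin (X u) v = - bilin u (X v).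
Proof.
rewrite /bilin trmx_mul -(mulmxA u^T) G_shift mulmxN mulNmx mxE.
by rewrite !mulmxA.
Qed.

Lemma bilin_eigen u v : bilin (L u) v = - bilin u (L v).
Proof.
rewrite /bilin trmx_mul tr_eigen_mx -(mulmxA u^T) G_eigen mulmxN mulNmx mxE.
by rewrite !mulmxA.
Qed.

Lemma bilin_radical_line u v :
  (forall w, bilin u w = 0) -> (forall w, bilin v w = 0) -> u != 0 ->
  exists c : R, v = c *: u.
Proof.
have ker x : (forall w, bilin x w = 0) -> (x^T <= kermx G)%MS.
  move=> h; apply/sub_kermxP/rowP => c; have := h (delta_mx c 0).
  by rewrite /bilin -colE mxE => ->; rewrite mxE.
move=> /ker hu /ker hv u0.
have ur : \rank u^T = 1%N.
  apply/eqP; rewrite eqn_leq rank_leq_row lt0n mxrank_eq0.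
  by apply: contra u0 => /eqP z; rewrite -[u]trmxK z trmx0.
have /mxrank_leqif_sup[_ eqr] := hu.
have ku : (kermx G <= u^T)%MS.
  rewrite -eqr eqn_leq mxrankS //= mxrank_ker ur leq_subLR addn1.
  by apply: leq_trans (leqSpred _) _; rewrite ltnS.
have /sub_rVP[c hc] := submx_trans hv ku.
by exists c; rewrite -[v]trmxK hc linearZ /= trmxK.
Qed.

Lemma form_normal_form : exists S : 'M[R]_N,
  [/\ S \in unitmx, shift_mx R n *m S = S *m shift_mx R n,
    eigen_mx n lam *m S = S *m eigen_mx n lam,
    forall r c c', (S^T *m G *m S) r c != 0 -> (S^T *m G *m S) r c' != 0 -> c = c'
    & forall r c, (S^T *m G *m S) r c != 0 -> (S^T *m G *m S) r c ^+ 2 = 1].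
Proof.
have [e he mono] := normal_form bilin_linl bilin_skew bilin_shift bilin_eigen
  eigen_shiftX n_gt0 bilin_radical_line basis_coordinates gen_vec_adapted.
exists (basis_mx e).
have entry i j a b : ((basis_mx e)^T *m G *m basis_mx e) (Rank i a) (Rank j b) =
    (-1) ^+ (n i - a.+1) *
      gram X bilin e i j ((n i - a.+1) + (n j - b.+1)).
  have -> : ((basis_mx e)^T *m G *m basis_mx e) (Rank i a) (Rank j b) =
      bilin (basis_mx e *m unit_vec i a) (basis_mx e *m unit_vec j b).
    rewrite /bilin (_ : (basis_mx e *m unit_vec i a)^T *m G *m
        (basis_mx e *m unit_vec j b) =
      (unit_vec i a)^T *m ((basis_mx e)^T *m G *m basis_mx e) *m unit_vec j b).
      by rewrite trmx_delta -rowE -colE [RHS]mxE [RHS]mxE.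
    by rewrite trmx_mul !mulmxA.
  rewrite !basis_unit_vec.
  exact: (D_pow_gram bilin_shift).
have nzP (y z : R) (t : bool) : y * (z * t%:R) != 0 -> t.
  by case: t => //; rewrite mulr0n !mulr0 eqxx.
split.
- exact: basis_mx_unit.
- exact: basis_mx_shift.
- exact: basis_mx_eigen.
- move=> r c c'; rewrite -(sig2K r) -(sig2K c) -(sig2K c') !entry.
  have [s [m [x [x2 h]]]] := mono (sig1 r); rewrite !h.
  move=> /nzP/andP[/eqP c1 /eqP c2] /nzP/andP[/eqP c1' /eqP c2'].
  have cc : sig1 c == sig1 c' by rewrite c1 c1'.
  apply/eqP; rewrite eq_RankE cc /=; move: (congr1 n (eqP cc)) c2 c2'.
  by move: (ltn_ord (sig2 c)) (ltn_ord (sig2 c')); clear; lia.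
- move=> r c; rewrite -(sig2K r) -(sig2K c) entry.
  have [s [m [x [x2 h]]]] := mono (sig1 r); rewrite h.
  by move=> /[dup]/nzP->; rewrite mulr1n mulr1 exprMn sqrr_sign mul1r.
Qed.

End Form.
End JordanBases.

Theorem proposition4p22 (R : realType) (p : nat) (n : 'I_p -> nat)
    (lam : 'I_p -> R) (p_gt0 : (0 < p)%N) (n_gt0 : forall i, (0 < n i)%N)
    (C : 'M[R]_(\sum_i n i))
    (hC : H_dot lam (if odd (\sum_i n i) then (\sum_i n i).-1
                     else (\sum_i n i)%N) C) :
  exists S P : 'M[R]_(\sum_i n i),
    [/\ T_dot lam S, is_perm_mx P
      & block_star S *m C *m S =
          if odd (\sum_i n i)
          then antidiag_mx n *m
                 (P^T *m sympl_pad_mx (\sum_i n i) (\sum_i n i).-1 *m P)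
          else antidiag_mx n *m (P^T *m sympl_mx (\sum_i n i) *m P)].
Proof.
have [skewC altC rankC eigC] := hC.
have skew := form_mx_skew skewC.
have rank_form : ((\sum_i n i).-1 <= \rank (form_mx C))%N.
  by rewrite form_mx_rank rankC; case: ifP => // _; apply: leq_pred.
have [S [unitS shiftS eigenS single unitary]] := form_normal_form n_gt0 skew
  (form_mx_shift altC) (form_mx_eigen eigC) rank_form.
set M := S^T *m form_mx C *m S in single unitary.
have skewM : M^T = - M.
  by rewrite /M trmx_mul [(S^T *m _)^T]trmx_mul trmxK skew mulNmx mulmxN mulmxA.
have [h [s [hN ME]]] := skew_signed_matching skewM single unitary.
have rankM : \rank M = \rank C.
  rewrite /M mxrankMfree ?row_free_unit // -(form_mx_rank C).
  have fullS : row_full S^T by rewrite row_full_unit unitmx_tr.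
  by rewrite (eqmxMfull _ fullS).
have hE : h = (\sum_i n i)./2.
  have : (\rank M <= h + h)%N.
    rewrite ME; apply: leq_trans (mxrankM_maxl _ _) _.
    by apply: leq_trans (mxrankM_maxr _ _) _; apply: matching_mx_rank.
  by move: hN; rewrite rankM rankC; clear; case: ifP; lia.
have starS : block_star S *m C *m S = antidiag_mx n *m M.
  by rewrite /M /block_star /form_mx !mulmxA.
exists S, (perm_mx s); split.
- split=> //; first exact/upper_toeplitzP.
  by apply/eigen_mx_commP.
- exact: perm_mx_is_perm.
- rewrite starS ME hE; case: ifP => oddN.
    rewrite sympl_pad_mx_matching ?leq_pred //; last by move: oddN; clear; lia.
    by congr (_ *m (_ *m matching_mx _ _ _ *m _)); move: oddN; clear; lia.
  by rewrite sympl_mx_matching ?oddN.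
Qed.
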